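(* For any positive integers $C$, $k$ and $\lambda$ with $k\geq 2\lambda+2$, there exists an integer $v_0$ such that the following holds. Let $G$ be a finite abelian group with $|G|>v_0$ such that the number of elements of order $2$ in $G$ is at most $C$. Then for any $(G,k,\lambda)$-difference family $\mathcal{F}$, one can choose for each base block $F\in\mathcal{F}$ an element $g_F\in G$ such that the translated blocks $F+g_F$ ($F\in\mathcal{F}$) form a $(G,k,\lambda)$-Banff difference family.
   Context: Let $(G,+)$ be a finite abelian group with identity $0$ and $2\leq k\leq |G|$. A $(G,k,\lambda)$-difference family (DF) is a collection (possibly with repetition) $\mathcal{F}$ of $k$-subsets of $G$ (base blocks) such that the multiset $\bigcup_{F\in\mathcal{F}}\{f-f'\mid f,f'\in F, f\neq f'\}$ contains each element of $G\setminus\{0\}$ exactly $\lambda$ times. For $F\subseteq G$ and $g\in G$, write $F+g=\{f+g\mid f\in F\}$ (a translation of $F$) and $-F=\{-f\mid f\in F\}$. A $(G,k,\lambda)$-DF is a Banff difference family (BDF) if all its base blocks and their negatives are mutually disjoint (i.e. the $2|\mathcal{F}|$ sets $F$, $-F$, $F\in\mathcal{F}$, are pairwise disjoint). Note that a translation of each base block of a DF again yields a DF. *)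

(* Defs.v *)
From mathcomp Require Import all_boot all_order all_fingroup all_algebra.

Set Implicit Arguments.
Unset Strict Implicit.
Unset Printing Implicit Defensive.

Import GRing.Theory.
Local Open Scope ring_scope.

Definition translate (G : finZmodType) (A : {set G}) (g : G) : {set G} :=
  [set f + g | f in A].

Definition negate (G : finZmodType) (A : {set G}) : {set G} :=
  [set - f | f in A].

(* The sequence stands for a multiset: one entry per ordered pair. *)
Definition differences (G : finZmodType) (A : {set G}) : seq G :=
  [seq p.1 - p.2 | p in [set p in setX A A | p.1 != p.2]].

(* A collection of base blocks, possibly with repetition, is a family indexed
   by ['I_n]. *)
Definition difference_family (G : finZmodType) (k lambda n : nat)
    (F : 'I_n -> {set G}) : Prop :=
  [/\ (2 <= k <= #|G|)%N,
      forall i : 'I_n, #|F i| = k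
    & forall d : G, d != 0 ->
        count_mem d (flatten [seq differences (F i) | i <- enum 'I_n])
          = lambda].

Definition signed_block (G : finZmodType) (n : nat) (F : 'I_n -> {set G})
    (a : 'I_n * bool) : {set G} :=
  if a.2 then negate (F a.1) else F a.1.

(* Disjointness is required between distinct indices, not distinct sets: a
   repeated block, or a block equal to its negative, is excluded. *)
Definition banff_difference_family (G : finZmodType) (k lambda n : nat)
    (F : 'I_n -> {set G}) : Prop :=
  difference_family k lambda F /\
  forall a b : 'I_n * bool, a != b ->
    [disjoint signed_block F a & signed_block F b].

(* [#[x]%g] is the order of [x] in the additive group of [G]. *)
Definition involutions (G : finZmodType) : {set G} :=
  [set x : G | #[x]%g == 2%N].

(* Main.v *)
(** Encode a family of blocks as a (k+1)-uniform hypergraph: its vertices are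
    the indices i of the blocks (the colours) and the pairs {x, -x} with
    2x <> 0, and its edges are the placements (i, g) for which F_i + g and
    -(F_i + g) are disjoint. A translated family is Banff iff its placements are
    pairwise disjoint edges, so a matching covering all colours is wanted. With
    v = |G|, colours have degree v - O(1), points have degree 2kn up to a small
    error in the mean, and codegrees are bounded because F is a difference
    family; 2kn is at most (1 - 1/k) v since k >= 2 lambda + 2.

    A derandomised nibble adds edges one at a time. After m steps a
    quasirandom matching leaves a fraction a = 1 - 2km/v of the points free, so
    the number of free edges at a vertex should be v a^k at a colour and
    2k(n - m) a^(k-1) at a point. The potential is the sum of the squared
    deviations from these ideal values. Averaged over all free edges, adding an
    edge multiplies (potential + v^2) by at most 1 + O(1/v), so some choice keeps
    the potential O(v^2) until all but a small proportion of the colours are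
    covered. Since a >= 1/k, all but O(1) colours then have a positive
    proportion of free edges. The exceptional colours are placed greedily,
    removing the O(1) edges they meet, and the remaining colours are placed
    greedily too. *)

Require Import Defs.
From mathcomp Require Import all_boot all_order all_fingroup all_algebra.
From mathcomp Require Import cyclic zify ring lra.

Set Implicit Arguments.
Unset Strict Implicit.
Unset Printing Implicit Defensive.

Import Order.TTheory GRing.Theory Num.Theory.

(** * Stars and free edges *)

Lemma leq_card_bigcup (I T : finType) (A : {set I}) (B : I -> {set T}) :
  #|\bigcup_(i in A) B i| <= \sum_(i in A) #|B i|.
Proof.
elim/big_rec2: _ => [|i n S _ le_S]; first by rewrite cards0.
by apply: leq_trans (leq_card_setU _ _) _; rewrite leq_add2l.
Qed.

Lemma card_setInd (T : finType) (A : {set T}) (P : pred T) :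
  #|[set x in A | P x]| = \sum_(x in A) P x.
Proof.
rewrite -sum1_card big_mkcond [RHS]big_mkcond /=.
by apply: eq_bigr => x _; rewrite inE; case: (x \in A); case: (P x).
Qed.

Section Hypergraph.

Variables (W E : finType) (V : E -> {set W}).
Implicit Types (U A Z : {set W}) (x y : W) (e : E) (M N : {set E}).

(** The centre [x] is exempt from avoiding [U], so the count stays meaningful at covered vertices
    and the potential can range over all vertices. *)
Definition star U x := [set e | (x \in V e) && [disjoint V e :\ x & U]].
Definition live U := [set e | [disjoint V e & U]].
Definition codeg x y := #|[set e | (x \in V e) && (y \in V e)]|.
Definition loss U x e' :=
  #|[set e in star U x | ~~ [disjoint V e :\ x & V e']]|.

Lemma disjointsU A (B D : {set W}) :
  [disjoint A & B :|: D] = [disjoint A & B] && [disjoint A & D].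
Proof. by rewrite -!setI_eq0 setIUr setU_eq0. Qed.

Lemma card_star_add U x e' :
  #|star (U :|: V e') x| + loss U x e' = #|star U x|.
Proof.
rewrite -(cardsID [set e | [disjoint V e :\ x & V e']] (star U x)).
congr (_ + _); apply: eq_card => e; rewrite !inE.
  by rewrite disjointsU andbA.
by rewrite andbC.
Qed.

Variables (r c : nat).
Hypothesis card_V : forall e, #|V e| <= r.
Hypothesis codegP : forall x y, x != y -> codeg x y <= c.

(** Such an edge passes through [x] and another vertex of [A]; the union bound over that vertex
    costs one codegree each. *)
Lemma card_meet_le x A :
  #|[set e | (x \in V e) && ~~ [disjoint V e :\ x & A]]| <= #|A| * c.
Proof.
have -> : [set e | (x \in V e) && ~~ [disjoint V e :\ x & A]] =
  \bigcup_(y in A :\ x) [set e | (x \in V e) && (y \in V e)].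
  apply/setP => e; rewrite inE; apply/andP/bigcupP.
    case=> xe /pred0Pn[y /=]; rewrite !inE => /andP[/andP[yx ye] yA].
    by exists y; rewrite !inE ?yx ?xe.
  case=> y; rewrite !inE => /andP[yx yA] /andP[-> ye]; split=> //.
  by apply/pred0Pn; exists y; rewrite /= !inE yx ye.
apply: leq_trans (leq_card_bigcup _ _) _.
apply: leq_trans (_ : #|A :\ x| * c <= _); last first.
  by rewrite leq_mul2r subset_leq_card ?orbT ?subD1set.
rewrite -sum_nat_const; apply: leq_sum => y; rewrite !inE => /andP[yx _].
by apply: codegP; rewrite eq_sym.
Qed.

Lemma loss_le U x e' : loss U x e' <= r * c.
Proof.
apply: leq_trans (_ : #|V e'| * c <= _); last by rewrite leq_mul2r card_V orbT.
apply: leq_trans (card_meet_le x (V e')); apply/subset_leq_card/subsetP => e.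
by rewrite !inE => /andP[/andP[-> _] ->].
Qed.

Lemma star_live U y : y \notin U -> star U y = [set e in live U | y \in V e].
Proof.
move=> yU; apply/setP => e; rewrite !inE andbC; case: (boolP (y \in V e)) => ye.
  rewrite !andbT -[V e in RHS](setD1K ye) -!setI_eq0 setIUl setU_eq0.
  suff -> : [set y] :&: U == set0 by [].
  by rewrite setI_eq0 disjoints1.
by rewrite !andbF.
Qed.

Definition hits U A := #|[set e in live U | ~~ [disjoint A & V e]]|.

Lemma sum_star U A : [disjoint A & U] ->
  \sum_(y in A) #|star U y| = \sum_(e in live U) #|A :&: V e|.
Proof.
move=> AU; under eq_bigr => y yA.
  rewrite star_live; last by rewrite (disjointFr AU).
  rewrite card_setInd; over.
rewrite exchange_big; apply: eq_bigr => e _; rewrite -card_setInd.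
by apply: eq_card => y; rewrite !inE.
Qed.

Lemma hits_le U A : [disjoint A & U] -> hits U A <= \sum_(y in A) #|star U y|.
Proof.
move=> AU; rewrite sum_star // /hits card_setInd; apply: leq_sum => e _.
by case: (boolP [disjoint A & V e]) => //=; rewrite -setI_eq0 -card_gt0.
Qed.

(** An edge meeting [A] in [t > 0] vertices is counted [t] times on the left and once in [hits]. The
    excess [t - 1] is at most [t * (t - 1)], and these ordered pairs are controlled by codegrees. *)
Lemma hits_ge U A : [disjoint A & U] -> #|A| <= r ->
  \sum_(y in A) #|star U y| <= hits U A + r ^ 2 * c.
Proof.
move=> AU Ar; rewrite sum_star // /hits card_setInd.
have pair_le : \sum_(y in A) \sum_(z in A :\ y) codeg y z <= r ^ 2 * c.
  apply: leq_trans (_ : #|A| * (#|A| * c) <= _); last first.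
    by rewrite mulnA leq_mul2r -mulnn leq_mul ?orbT.
  rewrite -sum_nat_const; apply: leq_sum => y yA.
  apply: leq_trans (_ : #|A :\ y| * c <= _); last first.
    by rewrite leq_mul2r subset_leq_card ?orbT ?subD1set.
  rewrite -sum_nat_const; apply: leq_sum => z; rewrite !inE => /andP[zy _].
  by apply: codegP; rewrite eq_sym.
apply: leq_trans (leq_add (leqnn _) pair_le).
have le_pairs : \sum_(e in live U) \sum_(y in A) \sum_(z in A :\ y)
    ((y \in V e) && (z \in V e)) <= \sum_(y in A) \sum_(z in A :\ y) codeg y z.
  rewrite exchange_big; apply: leq_sum => y _.
  rewrite exchange_big; apply: leq_sum => z _.
  rewrite -card_setInd; apply/subset_leq_card/subsetP => e.
  by rewrite !inE => /andP[].
apply: leq_trans (leq_add (leqnn _) le_pairs); rewrite -big_split /=.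
apply: leq_sum => e _; set T := A :&: V e.
have -> : \sum_(y in A) \sum_(z in A :\ y) ((y \in V e) && (z \in V e) : nat)
    = #|T| * #|T|.-1.
  rewrite -sum_nat_const (big_setID (V e)) /= [X in _ + X]big1 ?addn0.
    apply: eq_bigr => y yT; have ye : y \in V e by move: yT; rewrite inE => /andP[].
    rewrite ye /= -card_setInd (cardsD1 y T) yT /=.
    by apply: eq_card => z; rewrite !inE andbA.
  by move=> y; rewrite inE => /andP[/negPf ye _]; apply: big1 => z _; rewrite ye.
have -> : ~~ [disjoint A & V e] = (0 < #|T|) by rewrite card_gt0 setI_eq0.
by case: #|T| => [|t] //=; nia.
Qed.

(** Both sides count pairs of an edge of the star and a live edge that destroys it. With the two
    bounds on [hits], the mean loss at [x] is expressed through the star sizes of its companions, up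
    to a codegree error. *)
Lemma sum_loss U x :
  \sum_(e' in live U) loss U x e' = \sum_(e in star U x) hits U (V e :\ x).
Proof.
rewrite /loss /hits; under eq_bigr do rewrite card_setInd.
by rewrite exchange_big; apply: eq_bigr => e _; rewrite card_setInd.
Qed.

Lemma sum_loss_le U x : \sum_(e' in live U) loss U x e' <=
  \sum_(e in star U x) \sum_(y in V e :\ x) #|star U y|.
Proof.
rewrite sum_loss; apply: leq_sum => e; rewrite inE => /andP[_].
exact: hits_le.
Qed.

Lemma sum_loss_ge U x :
  \sum_(e in star U x) \sum_(y in V e :\ x) #|star U y| <=
  \sum_(e' in live U) loss U x e' + #|star U x| * (r ^ 2 * c).
Proof.
rewrite sum_loss -sum_nat_const -big_split /=; apply: leq_sum => e.
rewrite inE => /andP[_] eU; apply: hits_ge => //.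
by apply: leq_trans (card_V e); rewrite subset_leq_card ?subD1set.
Qed.

End Hypergraph.

(** * Matchings *)

Section Matching.

Variables (W E : finType) (V : E -> {set W}).
Implicit Types (U Q Z : {set W}) (x y : W) (e : E) (M N : {set E}).

Definition matching M := forall e e', e \in M -> e' \in M -> e != e' ->
  [disjoint V e & V e'].
Definition cov M := \bigcup_(e in M) V e.

Lemma sub_cov M e : e \in M -> V e \subset cov M.
Proof. by move=> eM; apply: bigcup_sup eM. Qed.

Lemma matching0 : matching set0.
Proof. by move=> e e'; rewrite inE. Qed.

Lemma cov0 : cov set0 = set0.
Proof. exact: big_set0. Qed.

Lemma matching_sub M N : N \subset M -> matching M -> matching N.
Proof. by move=> /subsetP NM mM e e' /NM eM /NM; apply: mM. Qed.

Lemma cov_sub M N : N \subset M -> cov N \subset cov M.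
Proof. by move=> /subsetP NM; apply/bigcupsP => e /NM; apply: sub_cov. Qed.

Lemma covU M N : cov (M :|: N) = cov M :|: cov N.
Proof. exact: bigcup_setU. Qed.

Lemma matchingU M N : matching M -> matching N ->
  [disjoint cov M & cov N] -> matching (M :|: N).
Proof.
move=> mM mN dMN e e'; rewrite !inE => /orP[eM|eN] /orP[e'M|e'N] ee'.
- exact: mM.
- exact: disjointWl (sub_cov eM) (disjointWr (sub_cov e'N) dMN).
- rewrite disjoint_sym.
  exact: disjointWl (sub_cov e'M) (disjointWr (sub_cov eN) dMN).
- exact: mN.
Qed.

Lemma matching1 e : matching [set e].
Proof. by move=> e1 e2; rewrite !inE => /eqP-> /eqP->; rewrite eqxx. Qed.

Lemma cov1 e : cov [set e] = V e.
Proof. exact: big_set1. Qed.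

Lemma card_matching_meet M Z : matching M ->
  #|[set e in M | ~~ [disjoint V e & Z]]| <= #|Z|.
Proof.
move=> mM; rewrite -[#|Z|]muln1 -sum_nat_const.
have -> : [set e in M | ~~ [disjoint V e & Z]] =
    \bigcup_(z in Z) [set e in M | z \in V e].
  apply/setP => e; rewrite inE; apply/andP/bigcupP.
    case=> eM /pred0Pn[z /= /andP[ze zZ]]; exists z; rewrite ?inE ?eM //.
  case=> z zZ; rewrite inE => /andP[-> ze]; split=> //.
  by apply/pred0Pn; exists z; rewrite /= ze.
apply: leq_trans (leq_card_bigcup _ _) _; apply: leq_sum => z _.
rewrite leqNgt; apply/negP => /card_gt1P[e [e' [+ + ee']]].
rewrite !inE => /andP[eM ze] /andP[e'M ze'].
by have := disjointFr (mM _ _ eM e'M ee') ze; rewrite ze'.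
Qed.

Variables (r c : nat) (col : {set W}).
Hypothesis card_V : forall e, #|V e| <= r.
Hypothesis codegP : forall x y, x != y -> codeg V x y <= c.
Hypothesis card_col : forall e, #|V e :&: col| = 1.

Lemma card_cov M : #|cov M| <= r * #|M|.
Proof.
apply: leq_trans (leq_card_bigcup _ _) _.
by rewrite mulnC -sum_nat_const; apply: leq_sum.
Qed.

(** Any available edge at a colour of [Q] will do: it contains no other colour, and at each
    remaining colour it destroys at most [r * c] edges, which the degree hypothesis pays for. *)
Lemma greedy_matching Q Z : Q \subset col ->
    (forall x, x \in Q -> r * c * #|Q| <
       #|[set e | (x \in V e) && [disjoint V e & Z]]|) ->
  exists M, [/\ matching M, [disjoint cov M & Z], Q \subset cov M
                & #|M| <= #|Q|].
Proof.
elim: {Q}#|Q| {-2}Q (erefl #|Q|) Z => [|q IH] Q cQ Z Qcol Qdeg.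
  exists set0; split; rewrite ?cov0 ?cards0 //; first exact: matching0.
  - by rewrite disjoints_subset sub0set.
  - by move/eqP: cQ; rewrite cards_eq0 => /eqP->.
have /card_gt0P[x xQ] : 0 < #|Q| by rewrite cQ.
have /card_gt0P[e] : 0 < #|[set e | (x \in V e) && [disjoint V e & Z]]|.
  by apply: leq_trans (Qdeg x xQ).
rewrite inE => /andP[xe eZ].
have cQx : #|Q :\ x| = q by move: cQ; rewrite (cardsD1 x) xQ => -[].
have [||M [mM dM QM cM]] := IH (Q :\ x) cQx (Z :|: V e).
- exact: subset_trans (subD1set _ _) Qcol.
- move=> y; rewrite !inE => /andP[yx yQ].
  have := Qdeg y yQ; rewrite cQ mulnS cQx.
  set X := [set _ | _]; set Y := [set _ | _] => XY.
  have ye : y \notin V e.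
    apply/negP => ye; have /eqP := card_col e; rewrite eqn_leq => /andP[+ _].
    apply/negP; rewrite -ltnNge; apply/card_gt1P; exists x, y.
    by rewrite !inE xe ye !(subsetP Qcol) // eq_sym.
  have : #|X| <= #|Y| + #|[set e' | (y \in V e') && ~~ [disjoint V e' :\ y & V e]]|.
    apply: leq_trans (leq_card_setU _ _); apply/subset_leq_card/subsetP => e'.
    rewrite !inE disjointsU => /andP[-> ->] /=.
    case: (boolP [disjoint V e' & V e]) => //= /pred0Pn[z /= /andP[ze' ze]].
    apply/pred0Pn; exists z; rewrite /= !inE ze ze' !andbT.
    by apply: contraNneq ye => <-.
  have := card_meet_le codegP y (V e).
  have := leq_mul (card_V e) (leqnn c).
  lia.
- exists (e |: M); split.
  + apply: matchingU => //; first exact: matching1.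
    rewrite cov1 disjoint_sym; apply: disjointWr dM; exact: subsetUr.
  + rewrite covU cov1 disjoint_sym disjointsU disjoint_sym eZ /=.
    by rewrite disjoint_sym; apply: disjointWr dM; exact: subsetUl.
  + rewrite covU cov1; apply/subsetP => y yQ; rewrite inE.
    case: (eqVneq y x) => [->|yx]; first by rewrite xe.
    by rewrite (subsetP QM) ?orbT // !inE yx.
  + apply: leq_trans (leq_card_setU _ _) _; rewrite cards1 cQ; lia.
Qed.

Lemma card_col_cov M : matching M -> #|M| <= #|cov M :&: col|.
Proof.
move=> mM.
have cP e : exists x, V e :&: col == [set x].
  have /cards1P[x ->] : #|V e :&: col| == 1 by rewrite card_col.
  by exists x.
pose f e := xchoose (cP e).
have fP e : V e :&: col = [set f e] by apply/eqP/(xchooseP (cP e)).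
have f_in e : f e \in V e :&: col by rewrite fP set11.
rewrite -(card_in_imset (f := f) (D := M)).
  apply/subset_leq_card/subsetP => _ /imsetP[e eM ->].
  have := f_in e; rewrite !inE => /andP[fe ->].
  by rewrite (subsetP (sub_cov eM)).
move=> e e' eM e'M fee'; apply/eqP; apply: contraT => ee'.
have := f_in e; have := f_in e'; rewrite -fee' !inE => /andP[f1 _] /andP[f2 _].
by have := disjointFr (mM _ _ eM e'M ee') f2; rewrite f1.
Qed.

Lemma card_col_cov_eq M : matching M -> #|cov M :&: col| = #|M|.
Proof.
move=> mM; apply/eqP; rewrite eqn_leq card_col_cov // andbT.
have -> : cov M :&: col = \bigcup_(e in M) (V e :&: col) by rewrite /cov big_distrl.
apply: leq_trans (leq_card_bigcup _ _) _.
by rewrite (eq_bigr (fun=> 1)) ?sum1_card.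
Qed.

(* The colours of [Bad] are placed first, at the expense of the edges of [M]
   they meet; the other colours still have many free edges. *)
Lemma complete_matching M (Bad : {set W}) : matching M -> Bad \subset col ->
    (forall x, x \in Bad -> r * c * #|Bad| < #|[set e | x \in V e]|) ->
    (forall x, x \in col -> x \notin Bad ->
       r * c * (#|Bad| + (#|col| - #|M| + r * #|Bad|)) < #|star V (cov M) x|) ->
  exists2 N, matching N & col \subset cov N.
Proof.
move=> mM Bcol Bdeg Gdeg.
have [|N1 [mN1 _ BN1 cN1]] := @greedy_matching Bad set0 Bcol.
  move=> x xB; apply: leq_trans (Bdeg x xB) _.
  apply/subset_leq_card/subsetP => e; rewrite !inE => -> /=.
  by rewrite disjoint_sym disjoints_subset sub0set.
pose M' := [set e in M | [disjoint V e & cov N1]].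
have sM' : M' \subset M by apply/subsetP => e; rewrite inE => /andP[].
have mM' := matching_sub sM' mM.
have dM' : [disjoint cov M' & cov N1].
  rewrite disjoint_sym; apply/bigcup_disjointP => e.
  by rewrite inE disjoint_sym => /andP[].
(* A matching has at most one edge through each vertex of [cov N1], so at most [r * #|Bad|] edges
   are dropped. *)
have cM' : #|M| <= #|M'| + r * #|Bad|.
  rewrite -(cardsID [set e | [disjoint V e & cov N1]] M) leq_add //.
    by apply: subset_leq_card; apply/subsetP => e; rewrite !inE.
  apply: leq_trans (_ : #|cov N1| <= _).
    apply: leq_trans (card_matching_meet (cov N1) mM).
    by apply: subset_leq_card; apply/subsetP => e; rewrite !inE andbC.
  by apply: leq_trans (card_cov _) _; rewrite leq_mul2l cN1 orbT.
have mP := matchingU mM' mN1 dM'; set P := M' :|: N1 in mP.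
have cQ : #|col :\: cov P| <= #|col| - #|M| + r * #|Bad|.
  have : #|col :\: cov P| <= #|col :\: cov M'|.
    by apply/subset_leq_card/setDS/cov_sub/subsetUl.
  have := cardsID (cov M') col; rewrite [_ :&: _]setIC card_col_cov_eq //.
  lia.
have [||N2 [mN2 dN2 QN2 _]] := @greedy_matching (col :\: cov P) (cov P).
- exact: subsetDl.
- move=> x; rewrite inE => /andP[xP xcol].
  have xB : x \notin Bad.
    by apply: contra xP => /(subsetP BN1); rewrite covU inE orbC => ->.
  have := Gdeg x xcol xB; set Y := [set _ | _].
  (* The colour [x] may lie in [cov M], its edge having been dropped; here it matters that a star
     ignores its centre. *)
  have : #|star V (cov M) x| <=
      #|Y| + #|[set e | (x \in V e) && ~~ [disjoint V e :\ x & cov N1]]|.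
    apply: leq_trans (leq_card_setU _ _); apply/subset_leq_card/subsetP => e.
    rewrite !inE => /andP[xe eM]; rewrite xe /=.
    case: (boolP [disjoint V e :\ x & cov N1]) => eN1; rewrite ?orbT //= orbF.
    have := star_live V xP; move/setP/(_ e); rewrite !inE xe /= andbT => <-.
    rewrite covU disjointsU eN1 andbT; apply: disjointWr eM; exact: cov_sub.
  have := card_meet_le codegP x (cov N1).
  have := leq_mul (card_cov N1) (leqnn c).
  have := leq_mul (leqnn (r * c)) cN1.
  have := leq_mul (leqnn (r * c)) cQ.
  rewrite mulnDr; lia.
exists (P :|: N2); first by apply: matchingU; rewrite // disjoint_sym.
rewrite covU; apply/subsetP => x xcol; rewrite inE.
case: (boolP (x \in cov P)) => //= xP.
by rewrite (subsetP QN2) // inE xP.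
Qed.

End Matching.

Local Open Scope ring_scope.

(** * The potential *)

(** Cauchy-Schwarz: expand into pairs and bound each product by the mean of the two squares. *)
Lemma sqr_sum_le (R : realFieldType) (T : finType) (f : T -> R) :
  (\sum_x f x) ^+ 2 <= #|T|%:R * \sum_x f x ^+ 2.
Proof.
rewrite expr2 mulr_suml; under eq_bigr do rewrite mulr_sumr.
have -> : #|T|%:R * \sum_x f x ^+ 2 =
    \sum_(x : T) \sum_(y : T) (f x ^+ 2 + f y ^+ 2) / 2.
  under [RHS]eq_bigr do rewrite -mulr_suml big_split /=.
  rewrite -mulr_suml big_split /=.
  under [X in X + _]eq_bigr do rewrite sumr_const.
  rewrite sumr_const sumrMnl -mulr_natl; by field.
apply: ler_sum => x _; apply: ler_sum => y _.
by have := sqr_ge0 (f x - f y); rewrite !expr2; lra.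
Qed.

Section Potential.

Variables (R : realFieldType) (W E : finType) (V : E -> {set W}).
Implicit Types (U : {set W}) (x y : W) (e : E) (I : W -> R).

Definition dev U I x : R := #|star V U x|%:R - I x.
Definition potential U I : R := \sum_x dev U I x ^+ 2.
Definition total_dev U I : R := \sum_x `|dev U I x|.

Lemma potential_ge0 U I : 0 <= potential U I.
Proof. by apply: sumr_ge0 => x _; apply: sqr_ge0. Qed.

Lemma total_dev_ge0 U I : 0 <= total_dev U I.
Proof. by apply: sumr_ge0. Qed.

Lemma total_dev_sqr_le U I : total_dev U I ^+ 2 <= #|W|%:R * potential U I.
Proof.
apply: le_trans (sqr_sum_le _) _; rewrite le_eqVlt; apply/orP; left; apply/eqP.
by congr (_ * _); apply: eq_bigr => x _; rewrite real_normK ?num_real.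
Qed.

Variables (r c : nat) (A v : R).
Hypothesis card_V : forall e, (#|V e| <= r)%N.
Hypothesis codegP : forall x y, x != y -> (codeg V x y <= c)%N.
Hypothesis degP : forall x, #|[set e | x \in V e]|%:R <= A * v.
Hypothesis v_ge1 : 1 <= v.
Hypothesis card_W : #|W|%:R <= 2 * v.
Hypothesis card_E : #|E|%:R <= v ^+ 2.

Lemma star_le U x : #|star V U x|%:R <= A * v.
Proof.
apply: le_trans (degP x); rewrite ler_nat.
by apply/subset_leq_card/subsetP => e; rewrite !inE => /andP[].
Qed.

(** After exchanging the sums, each companion [y] of [x] appears once per edge through both, hence
    at most [c] times. *)
Lemma sum_star_dev_le U I x :
  `|\sum_(e in star V U x) \sum_(y in V e :\ x) dev U I y| <=
  c%:R * total_dev U I.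
Proof.
apply: le_trans (ler_norm_sum _ _ _) _.
apply: le_trans (_ : \sum_(e in star V U x) \sum_(y in V e :\ x) `|dev U I y|
  <= _); first by apply: ler_sum => e _; apply: ler_norm_sum.
rewrite /total_dev mulr_sumr.
rewrite (exchange_big_dep predT) //=; apply: ler_sum => y _.
rewrite sumr_const -[X in X <= _]mulr_natl ler_wpM2r ?ler_nat //.
case: (eqVneq y x) => [->|yx].
  by rewrite eq_card0 // => e; rewrite -topredE /= !inE eqxx andbF.
apply: leq_trans (codegP (x := x) (y := y) _); last by rewrite eq_sym.
apply/subset_leq_card/subsetP => e; rewrite -topredE /= !inE.
by move=> /andP[/andP[-> _] /andP[_ ->]].
Qed.

(** [I] and [I'] are the ideal star sizes before and after a step, [J x] the ideal total at the
    companions of [x], and [Hh] the ideal number of live edges. The hypothesis [dIJ] is the rate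
    equation: summed over live edges, the ideal decrease matches the ideal loss up to [A * v]. *)
Variables (U : {set W}) (I I' J : W -> R) (Hh : R).
Hypothesis J_ge0 : forall x, 0 <= J x.
Hypothesis sumI : forall e x, x \in V e -> \sum_(y in V e :\ x) I y = J x.
Hypothesis A_ge0 : 0 <= A.
Hypothesis dI : forall x, `|I x - I' x| <= A.
Hypothesis dIJ : forall x, `|Hh * (I x - I' x) - I x * J x| <= A * v.
Hypothesis live_dev : `|#|live V U|%:R - Hh| <= total_dev U I.

Let S := total_dev U I.
Let B1 : R := A + c%:R + (r ^ 2 * c)%:R * A.

Lemma dev_add e x :
  dev (U :|: V e) I' x = dev U I x + (I x - I' x - (loss V U x e)%:R).
Proof. by rewrite /dev -(card_star_add V U x e) natrD; ring. Qed.

(* The term [- dev U I x * J x] of the drift has the favourable sign: it is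
   dropped, and what remains is of the order of [total_dev U I + v]. *)
Lemma drift_le x :
  2 * dev U I x * \sum_(e in live V U) (I x - I' x - (loss V U x e)%:R) <=
  2 * `|dev U I x| * (B1 * (S + v)).
Proof.
rewrite sumrB sumr_const -natr_sum -[(I x - I' x) *+ _]mulr_natl.
set L := (\sum_(e in live V U) loss V U x e)%N.
set D := #|star V U x|%:R : R.
have L_le := sum_loss_le V U x; have L_ge := sum_loss_ge card_V codegP U x.
rewrite -/L -(ler_nat R) in L_le; rewrite -/L -(ler_nat R) natrD natrM in L_ge.
have sum_starE : (\sum_(e in star V U x) \sum_(y in V e :\ x) #|star V U y|)%:R
    = \sum_(e in star V U x) \sum_(y in V e :\ x) dev U I y + D * J x :> R.
  rewrite natr_sum /D mulr_natl -sumr_const -big_split /=.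
  apply: eq_bigr => e; rewrite inE => /andP[xe _].
  by rewrite -(sumI xe) natr_sum -big_split; apply: eq_bigr => y _;
    rewrite /= /dev subrK.
have := sum_star_dev_le U I x.
move: L_le L_ge; rewrite sum_starE.
set T := \sum_(e in star V U x) _; set K := (r ^ 2 * c)%:R : R.
rewrite -/S => L_le L_ge T_le.
have DE : D = dev U I x + I x by rewrite /dev subrK.
have D_le : D <= A * v := star_le U x.
have D_ge0 : 0 <= D by rewrite ler0n.
have K_ge0 : 0 <= K by rewrite ler0n.
have S_ge0 : 0 <= S := total_dev_ge0 U I.
have DK_le : D * K <= K * A * v by rewrite mulrC -mulrA ler_wpM2l.
set H := #|live V U|%:R : R.
have H_le : `|(H - Hh) * (I x - I' x)| <= S * A by rewrite normrM ler_pM.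
set d := dev U I x in DE *.
(* In order: the error in the live count, the error in the rate equation, the deviations of the
   companions, the double counting, and the restoring term. *)
have -> : H * (I x - I' x) - L%:R = (H - Hh) * (I x - I' x)
   + (Hh * (I x - I' x) - I x * J x) - T + (T + D * J x - L%:R) - d * J x.
  by rewrite DE; ring.
set Q := (H - Hh) * _ + _ - T + _.
have Q_le : `|Q| <= B1 * (S + v).
  have [h1 h2] := (H_le, dIJ x).
  have c_ge0 : 0 <= c%:R :> R by rewrite ler0n.
  have p1 : 0 <= c%:R * v by rewrite mulr_ge0 // (le_trans ler01).
  have p2 : 0 <= K * A * S by rewrite !mulr_ge0.
  move: h1 h2 T_le; rewrite !ler_norml => /andP[? ?] /andP[? ?] /andP[? ?].
  rewrite /Q /B1 -/K; apply/andP; split; lra.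
rewrite mulrBr; have : 0 <= 2 * d * (d * J x).
  by have := mulr_ge0 (sqr_ge0 d) (J_ge0 x); lra.
have : 2 * d * Q <= 2 * `|d| * (B1 * (S + v)).
  rewrite -2!mulrA ler_pM2l ?ltr0n //.
  apply: le_trans (ler_norm _) _; rewrite normrM ler_wpM2l //.
lra.
Qed.

(** The first term absorbs the drift, once [v * S] is split into squares and [S ^+ 2] is bounded by
    Cauchy-Schwarz; the second bounds the squared one-step changes. *)
Definition growth_cst : R := 8 * B1 + 2 * (A + (r * c)%:R) ^+ 2.

Lemma sum_potential_le :
  \sum_(e in live V U) (potential (U :|: V e) I' - potential U I) <=
  growth_cst * (v * potential U I + v ^+ 3).
Proof.
have -> : \sum_(e in live V U) (potential (U :|: V e) I' - potential U I) =
  \sum_x (2 * dev U I x * \sum_(e in live V U) (I x - I' x - (loss V U x e)%:R)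
    + \sum_(e in live V U) (I x - I' x - (loss V U x e)%:R) ^+ 2).
  under eq_bigr => e _.
    rewrite /potential -sumrB; under eq_bigr do rewrite dev_add.
    over.
  rewrite exchange_big; apply: eq_bigr => x _.
  by rewrite mulr_sumr -big_split; apply: eq_bigr => e _ /=; ring.
rewrite big_split /=.
have S_ge0 : 0 <= S := total_dev_ge0 U I.
have B1_ge0 : 0 <= B1 by rewrite /B1 !addr_ge0 ?mulr_ge0 ?ler0n.
have first_le : \sum_x 2 * dev U I x *
    (\sum_(e in live V U) (I x - I' x - (loss V U x e)%:R)) <=
    2 * B1 * (S ^+ 2 + v * S).
  apply: le_trans (ler_sum _ (fun x _ => drift_le x)) _.
  by rewrite -mulr_suml -mulr_sumr -/(total_dev U I) -/S le_eqVlt;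
    apply/orP; left; apply/eqP; ring.
have second_le : \sum_x \sum_(e in live V U)
    (I x - I' x - (loss V U x e)%:R) ^+ 2 <=
    2 * v * v ^+ 2 * (A + (r * c)%:R) ^+ 2.
  have rc_ge0 : 0 <= (r * c)%:R :> R by rewrite ler0n.
  apply: le_trans (_ : #|W|%:R * (#|E|%:R * (A + (r * c)%:R) ^+ 2) <= _).
    rewrite -sum1_card natr_sum mulr_suml; apply: ler_sum => x _; rewrite mul1r.
    apply: le_trans (_ : \sum_(e in live V U) (A + (r * c)%:R) ^+ 2 <= _).
      apply: ler_sum => e _; rewrite -(real_normK (num_real (_ - _))).
      rewrite ler_sqr ?nnegrE ?addr_ge0 //.
      apply: le_trans (ler_normB _ _) _; rewrite lerD // normr_nat ler_nat.
      exact: loss_le.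
    by rewrite sumr_const -[X in X <= _]mulr_natl ler_wpM2r ?sqr_ge0 // ler_nat max_card.
  rewrite mulrA ler_wpM2r ?sqr_ge0 // ler_pM ?ler0n //.
have S2_le : S ^+ 2 <= 2 * v * potential U I.
  apply: le_trans (total_dev_sqr_le U I) _.
  by rewrite ler_wpM2r ?potential_ge0.
have vS : v * S <= v ^+ 2 + S ^+ 2 by nra.
have P0 := potential_ge0 U I.
have v3 : v ^+ 2 <= v ^+ 3 by rewrite ler_weXn2l.
have vP0 : 0 <= v * potential U I by rewrite mulr_ge0 // (le_trans ler01).
have h : 2 * B1 * (S ^+ 2 + v * S) <=
    8 * B1 * (v * potential U I + v ^+ 3).
  have -> : 8 * B1 * (v * potential U I + v ^+ 3) =
    2 * B1 * (4 * v * potential U I + 4 * v ^+ 3) by ring.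
  rewrite ler_wpM2l ?mulr_ge0 //; have := sqr_ge0 v; lra.
have h2 : 2 * v * v ^+ 2 * (A + (r * c)%:R) ^+ 2 <=
    2 * (A + (r * c)%:R) ^+ 2 * (v * potential U I + v ^+ 3).
  have := mulr_ge0 (sqr_ge0 (A + (r * c)%:R)) vP0; rewrite !exprS; lra.
rewrite /growth_cst mulrDl; lra.
Qed.

(** If every live edge did worse, the sum over at least [h * v ^+ 2] of them would exceed
    [sum_potential_le]. Adding [v ^+ 2] to the potential absorbs the additive error and makes the
    growth purely multiplicative. *)
Lemma exists_next_edge h : 0 < h -> h * v ^+ 2 <= #|live V U|%:R ->
  exists2 e, e \in live V U &
    potential (U :|: V e) I' + v ^+ 2 <=
    (potential U I + v ^+ 2) * (1 + growth_cst / h / v).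
Proof.
move=> h_gt0 H_ge.
have v_gt0 : 0 < v by exact: lt_le_trans ltr01 v_ge1.
have G_ge0 : 0 <= growth_cst.
  by rewrite /growth_cst /B1 addr_ge0 ?mulr_ge0 ?addr_ge0 ?mulr_ge0 ?ler0n ?sqr_ge0.
set a := growth_cst / h / v * (potential U I + v ^+ 2).
have [/existsP[e /andP[eL ele]]|/existsPn none] := boolP
  [exists e, (e \in live V U) &&
    (potential (U :|: V e) I' - potential U I <= a)].
  by exists e => //; rewrite /a in ele; lra.
have H_gt0 : 0 < #|live V U|%:R :> R.
  by apply: lt_le_trans H_ge; rewrite mulr_gt0 ?exprn_gt0.
have /card_gt0P[e0 e0L] : (0 < #|live V U|)%N by rewrite -(ltr0n R).
have := sum_potential_le; suff : growth_cst * (v * potential U I + v ^+ 3) <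
  \sum_(e in live V U) (potential (U :|: V e) I' - potential U I) by lra.
apply: le_lt_trans (_ : \sum_(e in live V U) a < _).
  rewrite sumr_const -[X in _ <= X]mulr_natl.
  have a_ge0 : 0 <= a.
    apply: mulr_ge0; first by rewrite !divr_ge0 // ltW.
    by rewrite addr_ge0 ?potential_ge0 // exprn_ge0 // ltW.
  apply: le_trans (_ : h * v ^+ 2 * a <= _); last by rewrite ler_wpM2r.
  rewrite le_eqVlt; apply/orP; left; apply/eqP; rewrite /a; field.
  by rewrite !gt_eqF.
apply: ltr_sum => [|e eL]; first by apply/hasP; exists e0; rewrite ?mem_index_enum.
by have := none e; rewrite eL /= -ltNge.
Qed.

End Potential.

(** * The nibble *)

Section PowerEstimates.

Variable R : realFieldType.
Implicit Types x y : R.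

Lemma subrX_bound x y j : 0 <= y -> y <= x -> x <= 1 ->
  0 <= x ^+ j - y ^+ j <= j%:R * (x - y).
Proof.
move=> y0 yx x1; elim: j => [|j /andP[IH0 IH]]; first by rewrite !expr0; lra.
have y1 : y ^+ j <= 1 by rewrite exprn_ile1 //; lra.
have yj0 : 0 <= y ^+ j by rewrite exprn_ge0.
have -> : x ^+ j.+1 - y ^+ j.+1 = x * (x ^+ j - y ^+ j) + (x - y) * y ^+ j.
  by rewrite !exprS; ring.
have x0 : 0 <= x by lra.
have h1 : x * (x ^+ j - y ^+ j) <= x ^+ j - y ^+ j.
  by rewrite -[leRHS]mul1r ler_wpM2r.
have h2 : (x - y) * y ^+ j <= x - y by rewrite -[leRHS]mulr1 ler_wpM2l //; lra.
apply/andP; split; first by rewrite addr_ge0 ?mulr_ge0 //; lra.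
by rewrite -natr1; lra.
Qed.

(** A first-order Taylor expansion at [x], replacing the derivative of the ideal trajectory; the
    remainder is carried through an induction on the exponent. *)
Lemma subrX_taylor x y j : 0 <= y -> y <= x -> x <= 1 ->
  `|x ^+ j - y ^+ j - j%:R * (x - y) * x ^+ j.-1| <= j%:R ^+ 2 * (x - y) ^+ 2.
Proof.
move=> y0 yx x1; elim: j => [|j IH].
  by rewrite !expr0 !subrr !mul0r subrr normr0 expr0n mul0r.
have /andP[b0 b1] := subrX_bound j y0 yx x1.
set D := x ^+ j - y ^+ j - j%:R * (x - y) * x ^+ j.-1 in IH.
have -> : x ^+ j.+1 - y ^+ j.+1 - j.+1%:R * (x - y) * x ^+ j.+1.-1 =
    x * D - (x - y) * (x ^+ j - y ^+ j).
  rewrite /D -natr1; case: j {IH b0 b1 D} => [|j] /=; first by rewrite !expr0; ring.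
  by rewrite !exprS; ring.
apply: le_trans (ler_normB _ _) _; rewrite normrM (ger0_norm (x := x)); last lra.
have h1 : x * `|D| <= `|D| by rewrite -[leRHS]mul1r ler_wpM2r.
have h2 : `|(x - y) * (x ^+ j - y ^+ j)| <= (x - y) * (j%:R * (x - y)).
  by rewrite ger0_norm ?mulr_ge0 ?ler_wpM2l //; lra.
have j0 : 0 <= j%:R :> R by rewrite ler0n.
have h3 : 0 <= (j%:R + 1) * (x - y) ^+ 2 :> R.
  by rewrite mulr_ge0 ?sqr_ge0 //; lra.
rewrite -natr1; lra.
Qed.

Lemma bernoulli_inv x j : 0 <= x -> (1 + x) ^+ j * (1 - j%:R * x) <= 1.
Proof.
move=> x0; elim: j => [|j IH]; first by rewrite expr0; lra.
apply: le_trans IH; have j0 : 0 <= j%:R :> R by rewrite ler0n.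
have -> : (1 + x) ^+ j.+1 * (1 - j.+1%:R * x) =
    (1 + x) ^+ j * ((1 + x) * (1 - (j%:R + 1) * x)).
  by rewrite exprS -natr1; ring.
rewrite ler_wpM2l ?exprn_ge0 ?addr_ge0 //.
by have := mulr_ge0 (addr_ge0 j0 ler01) (sqr_ge0 x); rewrite expr2; lra.
Qed.

(** An elementary substitute for the exponential: Bernoulli gives [(1 + x) ^+ v./2 <= 2] for
    [x = 1 / v], so the [v]-th power is at most 8, the third factor 2 serving odd [v]. Raising to
    the power [b] covers [beta]. *)
Lemma expr_1D_bound (b v m : nat) (beta : R) : (0 < v)%N -> (m <= v)%N ->
  0 <= beta -> beta <= b%:R -> (1 + beta / v%:R) ^+ m <= 8 ^+ b.
Proof.
move=> v0 mv b0 bb; set x := v%:R^-1 : R.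
have vR : 0 < v%:R :> R by rewrite ltr0n.
have x0 : 0 < x by rewrite invr_gt0.
have vx : v%:R * x = 1 by rewrite divff ?gt_eqF.
have x1 : x <= 1 by rewrite invf_le1 // ler1n.
have half : (1 + x) ^+ v./2 <= 2.
  have := bernoulli_inv v./2 (ltW x0).
  have : v./2%:R * x <= 2^-1.
    have : (v./2%:R + v./2%:R : R) <= v%:R by rewrite -natrD ler_nat; lia.
    by move=> /(ler_wpM2r (ltW x0)); rewrite vx; lra.
  have : 0 <= (1 + x) ^+ v./2 by rewrite exprn_ge0 //; lra.
  nra.
have full : (1 + x) ^+ v <= 8.
  have hp : 0 <= (1 + x) ^+ v./2 by rewrite exprn_ge0 //; lra.
  have -> : v = (odd v + v./2 + v./2)%N by lia.
  rewrite !exprD; apply: le_trans (_ : 2 * 2 * 2 <= _); last by lra.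
  have o0 : 0 <= (1 + x) ^+ odd v by rewrite exprn_ge0 //; lra.
  have o2 : (1 + x) ^+ odd v <= 2 by case: (odd v); rewrite ?expr0 ?expr1; lra.
  by apply: ler_pM; rewrite ?mulr_ge0 //; apply: ler_pM.
have bx : 1 + beta * x <= (1 + x) ^+ b.
  apply: le_trans (_ : 1 + b%:R * x <= _); first by rewrite lerD2l ler_wpM2r // ltW.
  elim: (b) => [|j IH]; first by rewrite expr0; lra.
  rewrite exprS -natr1; have j0 : 0 <= j%:R :> R by rewrite ler0n.
  have : (1 + x) * (1 + j%:R * x) <= (1 + x) * (1 + x) ^+ j.
    by rewrite ler_wpM2l //; lra.
  have := mulr_ge0 j0 (sqr_ge0 x); rewrite expr2; lra.
apply: le_trans (_ : (1 + beta * x) ^+ v <= _).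
  rewrite ler_weXn2l // lerDl mulr_ge0 // ltW //.
apply: le_trans (_ : ((1 + x) ^+ b) ^+ v <= _).
  by rewrite lerXn2r // nnegrE ?exprn_ge0 ?addr_ge0 ?mulr_ge0 // ltW.
rewrite -exprM mulnC exprM lerXn2r // nnegrE ?exprn_ge0 ?ler0n //; lra.
Qed.

End PowerEstimates.

(** One constant for all error terms of the ideal trajectory. The last bound,
    [8 * k ^ 5 + 4 * k ^ 3] when expanded, dictates the 12. *)
Lemma step_cst_bounds k : (0 < k)%N ->
  [/\ 2 * k <= 12 * k ^ 5, k * (2 * k) <= 12 * k ^ 5,
      2 * k * (2 * k * k).+1 <= 12 * k ^ 5, k ^ 2 * (2 * k) ^ 2 <= 12 * k ^ 5
    & 2 * k * (k ^ 2 * (2 * k) ^ 2 + k * (2 * k)) <= 12 * k ^ 5]%N.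
Proof.
move=> k0; have pw i j : (i <= j -> k ^ i <= k ^ j)%N by apply: leq_pexp2l.
have := pw 1%N 5%N isT; have := pw 2%N 5%N isT; have := pw 3%N 5%N isT.
have := pw 4%N 5%N isT; rewrite expn1 => h4 h3 h2 h1.
have e2 : (k ^ 2 = k * k)%N by [].
have e3 : (k ^ 3 = k * k * k)%N by rewrite expnS e2; ring.
have e4 : (k ^ 4 = k * k * k * k)%N by rewrite expnS e3; ring.
have e5 : (k ^ 5 = k * k * k * k * k)%N by rewrite expnS e4; ring.
by rewrite expnMn; split; lia.
Qed.

Section Nibble.

Variables (R : realFieldType) (W E : finType) (V : E -> {set W}).
Variables (col : {set W}) (k n v c : nat).
Hypothesis k_gt1 : (1 < k)%N.
Hypothesis n_le_v : (n <= v)%N.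
Hypothesis v_le_n : (v <= c * n)%N.
Hypothesis n_gt0 : (0 < n)%N.
Hypothesis room : (2 * k * n * k <= k.-1 * v)%N.
Hypothesis cardVcol : forall e, #|V e :&: col| = 1%N.
Hypothesis cardVpt : forall e, #|V e :\: col| = k.
Hypothesis codegP : forall x y, x != y -> (codeg V x y <= c)%N.
Hypothesis cardcol : #|col| = n.
Hypothesis degP : forall x, (#|[set e | x \in V e]| <= 2 * k * v)%N.
Hypothesis cardW : (#|W| <= 2 * v)%N.
Hypothesis cardE : (#|E| <= v ^ 2)%N.

Definition free_frac (m : nat) : R := 1 - (2 * k * m)%:R / v%:R.
(** Heuristically, a colour has [v] placements, each with [k] points to be free; a point lies in
    [2 * k] placements of each of the [n - m] remaining colours, each with [k - 1] further points to
    be free. *)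
Definition ideal_col m : R := v%:R * free_frac m ^+ k.
Definition ideal_pt m : R := (2 * k * (n - m))%:R * free_frac m ^+ k.-1.
Definition ideal m x : R := if x \in col then ideal_col m else ideal_pt m.

Let a := free_frac.
Let t : R := (2 * k)%:R / v%:R.

Let v_gt0 : (0 < v)%N. Proof. exact: leq_trans n_le_v. Qed.
Let vR_gt0 : 0 < v%:R :> R. Proof. by rewrite ltr0n. Qed.
Let kR_gt0 : 0 < k%:R :> R. Proof. by rewrite ltr0n ltnW. Qed.

Let cardV e : #|V e| = k.+1.
Proof. by rewrite -(cardsID col) cardVcol cardVpt. Qed.

(** This is the purpose of [room]: even all [n] blocks with their negatives leave a proportion
    [1 / k] of the group free. *)
Lemma free_frac_ge m : (m <= n)%N -> k%:R^-1 <= a m.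
Proof.
move=> mn; rewrite /a /free_frac -(@ler_pM2r _ (k%:R * v%:R)) ?mulr_gt0 //.
rewrite mulrA mulVf ?gt_eqF // mul1r mulrBl mul1r.
have -> : (2 * k * m)%:R / v%:R * (k%:R * v%:R) = (2 * k * m * k)%:R :> R.
  by rewrite [in RHS]natrM; field; rewrite gt_eqF.
rewrite lerBrDr -natrM -natrD ler_nat.
have -> : (k * v = k.-1 * v + v)%N by rewrite addnC -mulSn prednK // ltnW.
rewrite addnC leq_add2r; apply: leq_trans room.
by rewrite leq_mul2r leq_mul2l mn !orbT.
Qed.

Lemma free_frac_le1 m : a m <= 1.
Proof. by rewrite /a /free_frac gerBl divr_ge0 ?ler0n. Qed.

Lemma free_fracS m : a m.+1 = a m - t.
Proof. by rewrite /a /free_frac /t mulnS natrD; ring. Qed.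

Let vt : v%:R * t = (2 * k)%:R.
Proof. by rewrite /t; field; rewrite gt_eqF. Qed.

Let t_ge0 : 0 <= t. Proof. by rewrite divr_ge0 ?ler0n. Qed.

Let a_ge0 m : (m <= n)%N -> 0 <= a m.
Proof. by move=> /free_frac_ge; apply: le_trans; rewrite invr_ge0 ltW. Qed.

Let step_a m : (m < n)%N -> [/\ 0 <= a m - t, a m - t <= a m & a m <= 1].
Proof.
move=> mn; rewrite -free_fracS a_ge0 // free_frac_le1; split=> //.
by rewrite free_fracS gerBl.
Qed.

Definition step_cst : R := (12 * k ^ 5)%:R.

Lemma ideal_col_step m : (m < n)%N ->
  `|ideal_col m - ideal_col m.+1| <= step_cst.
Proof.
move=> mn; have [h1 h2 h3] := step_a mn.
rewrite /ideal_col -/(a m) -/(a m.+1) free_fracS -mulrBr.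
have /andP[l u] := subrX_bound k h1 h2 h3.
rewrite ger0_norm ?mulr_ge0 //; apply: le_trans (ler_wpM2l (ltW vR_gt0) u) _.
have -> : v%:R * (k%:R * (a m - (a m - t))) = k%:R * (v%:R * t) by ring.
by rewrite vt -natrM /step_cst ler_nat; case: (step_cst_bounds (ltnW k_gt1)).
Qed.

Lemma ideal_pt_step m : (m < n)%N ->
  `|ideal_pt m - ideal_pt m.+1| <= step_cst.
Proof.
move=> mn; have [h1 h2 h3] := step_a mn.
rewrite /ideal_pt -/(a m) -/(a m.+1) free_fracS.
have /andP[l u] := subrX_bound k.-1 h1 h2 h3.
set X := a m ^+ _ in l u *; set Y := (a m - t) ^+ _ in l u *.
have Y0 : 0 <= Y by rewrite exprn_ge0.
have Y1 : Y <= 1 by rewrite exprn_ile1 //; lra.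
have sv : ((n - m.+1).+1 <= v)%N.
  by rewrite subnSK // (leq_trans (leq_subr _ _)).
rewrite -(subnSK mn); set s := (n - m.+1)%N in sv *.
have -> : (2 * k * s.+1)%:R * X - (2 * k * s)%:R * Y =
    (2 * k)%:R * (s.+1%:R * (X - Y) + Y).
  by rewrite !natrM -natr1; ring.
have uX : s.+1%:R * (X - Y) <= (2 * k * k)%:R.
  apply: le_trans (_ : v%:R * (k%:R * t) <= _); last first.
    by rewrite mulrCA vt -natrM ler_nat mulnC.
  apply: ler_pM; rewrite ?ler0n ?ler_nat //.
  apply: le_trans u _; have -> : a m - (a m - t) = t by ring.
  by rewrite ler_wpM2r // ler_nat leq_pred.
rewrite ger0_norm; last by rewrite mulr_ge0 ?addr_ge0 ?mulr_ge0 ?ler0n.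
apply: le_trans (_ : (2 * k)%:R * ((2 * k * k)%:R + 1) <= _).
  by rewrite ler_wpM2l ?ler0n // lerD.
by rewrite natr1 -natrM /step_cst ler_nat; case: (step_cst_bounds (ltnW k_gt1)).
Qed.

Definition ideal_live m : R := (n - m)%:R * ideal_col m.
Definition ideal_rest m x : R := ideal_col m + k%:R * ideal_pt m - ideal m x.

(** The two products agree to first order in [t]. The Taylor remainder, of order [t ^+ 2], is
    multiplied by at most [v ^+ 3], and [v * t = 2 * k] leaves a single factor [v]. *)
Lemma ideal_col_drift m : (m < n)%N ->
  `|ideal_live m * (ideal_col m - ideal_col m.+1)
     - ideal_col m * (k%:R * ideal_pt m)| <= step_cst * v%:R.
Proof.
move=> mn; have [h1 h2 h3] := step_a mn.
have := subrX_taylor k h1 h2 h3.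
rewrite /ideal_live /ideal_col /ideal_pt -/(a m) -/(a m.+1) free_fracS.
have -> : a m - (a m - t) = t by ring.
set X := a m ^+ k.-1; set Y := (a m - t) ^+ k; set Z := a m ^+ k => T.
have -> : (n - m)%:R * (v%:R * Z) * (v%:R * Z - v%:R * Y)
     - v%:R * Z * (k%:R * ((2 * k * (n - m))%:R * X)) =
   (n - m)%:R * Z * (v%:R ^+ 2 * (Z - Y - k%:R * t * X)).
  by rewrite [(2 * k * (n - m))%:R]natrM -vt; ring.
have Z0 : 0 <= Z by rewrite exprn_ge0 // a_ge0 // ltnW.
have Z1 : Z <= 1 by rewrite exprn_ile1 // a_ge0 // ltnW.
rewrite normrM ger0_norm ?mulr_ge0 ?ler0n // normrM ger0_norm ?exprn_ge0 ?ler0n //.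
apply: le_trans (_ : (v%:R * 1) * (v%:R ^+ 2 * (k%:R ^+ 2 * t ^+ 2)) <= _).
  apply: ler_pM; first by rewrite mulr_ge0 ?ler0n.
  - by rewrite mulr_ge0 // exprn_ge0 ?ler0n.
  - apply: ler_pM; rewrite ?ler0n // ler_nat.
    exact: leq_trans (leq_subr _ _) n_le_v.
  by rewrite ler_wpM2l ?exprn_ge0 ?ler0n.
have -> : v%:R * 1 * (v%:R ^+ 2 * (k%:R ^+ 2 * t ^+ 2)) =
  k%:R ^+ 2 * (v%:R * t) ^+ 2 * v%:R by ring.
rewrite vt ler_wpM2r ?ler0n //.
by rewrite -!natrX -natrM /step_cst ler_nat; case: (step_cst_bounds (ltnW k_gt1)).
Qed.

Lemma ideal_pt_drift m : (m < n)%N ->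
  `|ideal_live m * (ideal_pt m - ideal_pt m.+1)
     - ideal_pt m * (ideal_col m + k.-1%:R * ideal_pt m)| <= step_cst * v%:R.
Proof.
move=> mn; have [h1 h2 h3] := step_a mn.
have := subrX_taylor k.-1 h1 h2 h3.
have /andP[] := subrX_bound k.-1 h1 h2 h3.
rewrite /ideal_live /ideal_col /ideal_pt -/(a m) -/(a m.+1) free_fracS.
have -> : a m - (a m - t) = t by ring.
have -> : a m ^+ k = a m * a m ^+ k.-1 by rewrite -exprS prednK // ltnW.
have aX : a m ^+ k.-1 = a m * a m ^+ k.-1.-1.
  by rewrite -exprS prednK // -ltnS prednK // ltnW.
set X := a m ^+ k.-1 in aX *; set X2 := a m ^+ _ in aX *.
set Y := (a m - t) ^+ _ => l u T.
have sv : ((n - m.+1).+1 <= v)%N.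
  by rewrite subnSK // (leq_trans (leq_subr _ _)).
rewrite -(subnSK mn); set s := (n - m.+1)%N in sv *; set j := k.-1%:R : R.
set b := s.+1%:R : R; have sE : s%:R = b - 1 :> R by rewrite /b -natr1 addrK.
have a0 : 0 <= a m by rewrite a_ge0 // ltnW.
have X0 : 0 <= X by rewrite exprn_ge0.
have X1 : X <= 1 by rewrite exprn_ile1.
have b0 : 0 <= b by rewrite ler0n.
have bv : b <= v%:R by rewrite ler_nat.
have jk : j <= k%:R by rewrite ler_nat leq_pred.
have j0 : 0 <= j by rewrite ler0n.
rewrite ![(2 * k * _)%:R]natrM -vt -/b sE.
set T1 := X - Y - _ in T.
(* After the first-order terms cancel, [b * T1] is the Taylor remainder and [X - Y] the cross term
   from [n - m] and the free fraction changing together. The relation [aX] avoids dividing by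
   [a m]. *)
have -> : b * (v%:R * (a m * X)) * (v%:R * t * b * X - v%:R * t * (b - 1) * Y) -
    v%:R * t * b * X * (v%:R * (a m * X) + j * (v%:R * t * b * X)) =
    (v%:R * t * b * X) * (v%:R * a m) * (b * T1 - (X - Y)).
  by rewrite /T1; ring: aX.
rewrite vt normrM; have -> : `|(2 * k)%:R * b * X * (v%:R * a m)| =
   (2 * k)%:R * b * X * (v%:R * a m).
  by rewrite ger0_norm // ?mulr_ge0 ?ler0n.
apply: le_trans (_ : (2 * k)%:R * v%:R * 1 * (v%:R * 1) *
  (v%:R * (k%:R ^+ 2 * t ^+ 2) + k%:R * t) <= _).
  apply: ler_pM; rewrite ?mulr_ge0 ?ler0n //.
    apply: ler_pM; rewrite ?mulr_ge0 ?ler0n //.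
      by apply: ler_pM; rewrite ?mulr_ge0 ?ler0n // ler_wpM2l ?ler0n.
    by rewrite ler_wpM2l ?ler0n // free_frac_le1.
  apply: le_trans (ler_normB _ _) _; apply: lerD.
    rewrite normrM ger0_norm // ler_pM //; apply: le_trans T _.
    by rewrite ler_wpM2r ?sqr_ge0 // ler_sqr ?nnegrE ?ler0n.
  by rewrite ger0_norm //; apply: le_trans u _; rewrite ler_wpM2r.
have -> : (2 * k)%:R * v%:R * 1 * (v%:R * 1) *
  (v%:R * (k%:R ^+ 2 * t ^+ 2) + k%:R * t) =
  (2 * k)%:R * (k%:R ^+ 2 * (v%:R * t) ^+ 2 + k%:R * (v%:R * t)) * v%:R by ring.
rewrite vt ler_wpM2r ?ler0n // -!natrX -!natrM -natrD -natrM /step_cst ler_nat.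
by case: (step_cst_bounds (ltnW k_gt1)).
Qed.

Lemma sum_ideal m e x : x \in V e ->
  \sum_(y in V e :\ x) ideal m y = ideal_rest m x.
Proof.
move=> xe; have : \sum_(y in V e) ideal m y = ideal_col m + k%:R * ideal_pt m.
  rewrite (big_setID col) /= (eq_bigr (fun=> ideal_col m)); last first.
    by move=> y; rewrite inE /ideal => /andP[_ ->].
  rewrite sumr_const cardVcol [X in _ + X](eq_bigr (fun=> ideal_pt m)); last first.
    by move=> y; rewrite inE /ideal => /andP[/negPf->].
  by rewrite sumr_const cardVpt mulr1n mulr_natl.
by rewrite (big_setD1 x) //= /ideal_rest => <-; rewrite addrAC subrr add0r.
Qed.

Let ideal_ge0 m : (m < n)%N -> 0 <= ideal_col m /\ 0 <= ideal_pt m.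
Proof.
move=> mn; have a0 : 0 <= a m by rewrite a_ge0 // ltnW.
by split; rewrite mulr_ge0 ?ler0n // exprn_ge0.
Qed.

Let kE : k%:R = 1 + k.-1%:R :> R.
Proof. by rewrite nat1r prednK // ltnW. Qed.

Lemma ideal_rest_ge0 m x : (m < n)%N -> 0 <= ideal_rest m x.
Proof.
move=> /ideal_ge0[c0 p0]; rewrite /ideal_rest /ideal kE mulrDl mul1r.
have := mulr_ge0 (ler0n R k.-1) p0; by case: ifP => _; lra.
Qed.

(** Each live edge contains exactly one colour, necessarily uncovered, so the live edges are counted
    by the stars of the [n - m] uncovered colours. *)
Lemma live_dev_le M m : matching V M -> #|M| = m ->
  `|#|live V (cov V M)|%:R - ideal_live m| <=
  total_dev V (cov V M) (ideal m).
Proof.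
move=> mM cM; set U := cov V M; set C := col :\: U.
have CU : [disjoint C & U] by rewrite -setI_eq0 setIDAC -setIDA setDv setI0.
have cC : #|C| = (n - m)%N.
  have := cardsID U col.
  by rewrite [_ :&: _]setIC (card_col_cov_eq cardVcol) // -/C; lia.
have := sum_star V CU; rewrite [RHS](eq_bigr (fun=> 1%N)); last first.
  move=> e; rewrite inE => eU; rewrite -(cardVcol e); apply: eq_card => y.
  rewrite !inE; case: (boolP (y \in V e)) => ye; rewrite ?andbF // andbT.
  by rewrite (disjointFr eU ye).
rewrite sum1_card => <-; rewrite /ideal_live -cC mulr_natl -sumr_const natr_sum.
rewrite -sumrB; apply: le_trans (ler_norm_sum _ _ _) _.
rewrite /total_dev [leRHS](bigID (mem C)) /= -[leLHS]addr0.
apply: lerD; last by apply: sumr_ge0.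
by apply: ler_sum => x; rewrite inE /dev /ideal => /andP[_ ->].
Qed.

Definition nibble_growth : R := growth_cst k.+1 c step_cst.

Lemma nibble_growth_ge0 : 0 <= nibble_growth.
Proof.
by rewrite /nibble_growth /growth_cst !(addr_ge0, mulr_ge0, sqr_ge0, ler0n).
Qed.

Lemma nibble_step M m h : matching V M -> #|M| = m -> (m < n)%N -> 0 < h ->
    h * v%:R ^+ 2 <= #|live V (cov V M)|%:R ->
  exists N, [/\ matching V N, #|N| = m.+1 &
    potential V (cov V N) (ideal m.+1) + v%:R ^+ 2 <=
    (potential V (cov V M) (ideal m) + v%:R ^+ 2) *
      (1 + nibble_growth / h / v%:R)].
Proof.
move=> mM cM mn h0 hH.
have [|||||||||||e eL ele] := @exists_next_edge R W E V k.+1 c step_cst v%:R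
  _ codegP _ _ _ _ (cov V M) (ideal m) (ideal m.+1) (ideal_rest m)
  (ideal_live m) _ _ _ _ _ _ h h0 hH.
- by move=> e; rewrite cardV.
- move=> x; rewrite /step_cst -natrM ler_nat; apply: leq_trans (degP x) _.
  by rewrite leq_mul2r; case: (step_cst_bounds (ltnW k_gt1)) => ->; rewrite orbT.
- by rewrite ler1n.
- by rewrite -natrM ler_nat.
- by rewrite -natrX ler_nat.
- by move=> x; apply: ideal_rest_ge0.
- by move=> e x; apply: sum_ideal.
- by rewrite ler0n.
- move=> x; rewrite /ideal; case: ifP => _; first exact: ideal_col_step.
  exact: ideal_pt_step.
- move=> x; rewrite /ideal_rest /ideal; case: ifP => _.
    by rewrite addrAC subrr add0r; apply: ideal_col_drift.
  rewrite kE mulrDl mul1r.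
  have -> : ideal_col m + (ideal_pt m + k.-1%:R * ideal_pt m) - ideal_pt m =
    ideal_col m + k.-1%:R * ideal_pt m by ring.
  exact: ideal_pt_drift.
- exact: live_dev_le.
have dM : [disjoint V e & cov V M] by move: eL; rewrite inE.
have eM : e \notin M.
  apply/negP => eM; have := cardV e.
  move: (disjointWr (sub_cov V eM) dM); rewrite -setI_eq0 setIid => /eqP->.
  by rewrite cards0.
exists (e |: M); split.
- by apply: matchingU; rewrite ?cov1 //; apply: matching1.
- by rewrite cardsU1 eM cM.
- by rewrite covU cov1 setUC.
Qed.

(** Half the ideal proportion of live edges while at least [n / q] colours, hence [v / (c * q)], are
    uncovered, the free fraction being at least [1 / k]. *)
Definition live_frac (q : nat) : R := (2 * (c * q * k ^ k)%:R)^-1.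

(** Iterating [nibble_step], the growth factors multiply to at most [8 ^+ b], so the potential stays
    [O(v^2)]. By Cauchy-Schwarz the total deviation is then [O(v^(3/2))], too small to exhaust the
    live edges. The predecessor of [m] appears because the last step needs live edges only before it
    is made. *)
Lemma nibble (q b : nat) (P0 : R) : (0 < q)%N ->
    nibble_growth / live_frac q <= b%:R ->
    potential V set0 (ideal 0) <= P0 * v%:R ^+ 2 ->
    2 * ((P0 + 1) * 8 ^+ b) <= live_frac q ^+ 2 * v%:R ->
  forall m, (m <= n)%N -> (n <= q * (n - m.-1))%N ->
  exists M, [/\ matching V M, #|M| = m &
    potential V (cov V M) (ideal m) <= (P0 + 1) * 8 ^+ b * v%:R ^+ 2].
Proof.
move=> q0 hb hP hv.
set h := live_frac q in hb hv.
have c_gt0 : (0 < c)%N by case: (c) v_le_n => //; move: v_gt0; lia.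
have k0 : (0 < k ^ k)%N by rewrite expn_gt0 ltnW.
have h0 : 0 < h by rewrite invr_gt0 mulr_gt0 ?ltr0n // !muln_gt0 c_gt0 q0.
have beta0 : 0 <= nibble_growth / h by rewrite divr_ge0 ?nibble_growth_ge0 // ltW.
have P01 : 0 <= P0.
  have := le_trans (potential_ge0 V set0 (ideal 0)) hP.
  by rewrite pmulr_lge0 ?exprn_gt0.
set x := 1 + nibble_growth / h / v%:R.
have xb m : (m <= v)%N -> x ^+ m <= 8 ^+ b by move=> mv; apply: expr_1D_bound.
suff main m : (m <= n)%N -> (n <= q * (n - m.-1))%N -> exists M,
  [/\ matching V M, #|M| = m & potential V (cov V M) (ideal m) + v%:R ^+ 2 <=
    (P0 + 1) * x ^+ m * v%:R ^+ 2].
  move=> m mn mq; have [M [mM cM pM]] := main m mn mq; exists M; split=> //.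
  apply: le_trans (_ : (P0 + 1) * x ^+ m * v%:R ^+ 2 <= _).
    by apply: le_trans pM; rewrite lerDl exprn_ge0 ?ler0n.
  rewrite ler_wpM2r ?exprn_ge0 ?ler0n // ler_wpM2l ?addr_ge0 //.
  by apply: xb; apply: leq_trans n_le_v.
elim: m => [|m IH] mn mq.
  exists set0; rewrite cards0 cov0 expr0 mulr1 mulrDl mul1r lerD2r; split=> //.
  exact: matching0.
have [||M [mM cM pM]] := IH; first exact: ltnW.
  by apply: leq_trans mq _; rewrite leq_mul2l leq_sub2l ?orbT // leq_pred.
have H_ge : h * v%:R ^+ 2 <= #|live V (cov V M)|%:R.
  have := live_dev_le mM cM; set S := total_dev _ _ _; set H := #|_|%:R.
  have S_le : S <= h * v%:R ^+ 2.
    rewrite -ler_sqr ?nnegrE ?total_dev_ge0 //; last first.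
      by rewrite mulr_ge0 ?exprn_ge0 ?ler0n // ltW.
    apply: le_trans (total_dev_sqr_le _ _ _) _.
    have pM' : potential V (cov V M) (ideal m) <= (P0 + 1) * 8 ^+ b * v%:R ^+ 2.
      apply: le_trans (_ : (P0 + 1) * x ^+ m * v%:R ^+ 2 <= _).
        by apply: le_trans pM; rewrite lerDl exprn_ge0 ?ler0n.
      rewrite ler_wpM2r ?exprn_ge0 ?ler0n // ler_wpM2l ?addr_ge0 //.
      by apply: xb; apply: leq_trans n_le_v; apply: ltnW.
    apply: le_trans (_ : 2 * v%:R * ((P0 + 1) * 8 ^+ b * v%:R ^+ 2) <= _).
      by rewrite ler_pM ?ler0n ?potential_ge0 // -natrM ler_nat.
    have -> : 2 * v%:R * ((P0 + 1) * 8 ^+ b * v%:R ^+ 2) =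
      2 * ((P0 + 1) * 8 ^+ b) * v%:R ^+ 3 by ring.
    have -> : (h * v%:R ^+ 2) ^+ 2 = h ^+ 2 * v%:R * v%:R ^+ 3 by ring.
    by rewrite ler_wpM2r // exprn_ge0 ?ler0n.
  have L_ge : 2 * h * v%:R ^+ 2 <= ideal_live m.
    have am := free_frac_ge (ltnW mn).
    have ak : k%:R^-1 ^+ k <= a m ^+ k.
      by rewrite lerXn2r ?nnegrE ?invr_ge0 ?ler0n // a_ge0 // ltnW.
    apply: le_trans (_ : (n - m)%:R * (v%:R * k%:R^-1 ^+ k) <= _); last first.
      by rewrite ler_wpM2l ?ler0n // ler_wpM2l ?ler0n.
    have nm : v%:R <= (c * q)%:R * (n - m)%:R :> R.
      rewrite -natrM ler_nat; apply: leq_trans v_le_n _.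
      by rewrite -mulnA leq_mul2l mq orbT.
    have -> : 2 * h * v%:R ^+ 2 = (c * q)%:R^-1 * v%:R * (v%:R * k%:R^-1 ^+ k).
      rewrite /h /live_frac natrM natrX exprVn; field.
      by rewrite expf_neq0 ?pnatr_eq0 -?lt0n ?c_gt0 ?q0 ?(ltnW k_gt1).
    rewrite ler_wpM2r ?mulr_ge0 ?ler0n ?exprn_ge0 ?invr_ge0 ?ler0n //.
    by rewrite ler_pdivrMl ?ltr0n ?muln_gt0 ?c_gt0.
  by rewrite ler_norml => /andP[+ _]; lra.
have [N [mN cN pN]] := nibble_step mM cM mn h0 H_ge.
exists N; split=> //; apply: le_trans pN _; rewrite -/x.
apply: le_trans (ler_wpM2r _ pM) _; first by rewrite addr_ge0 // divr_ge0 ?ler0n.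
by rewrite [x ^+ m.+1]exprSr mulrA [leRHS]mulrAC.
Qed.

(** A Chebyshev bound: the ideal star of a colour is at least [v / k ^ k], so a deficient colour
    deviates by at least half of that. *)
Lemma card_deficient_le U m (K : nat) : (m <= n)%N ->
    potential V U (ideal m) <= K%:R * v%:R ^+ 2 ->
  (#|[set x in col | 2 * k ^ k * #|star V U x| < v]| <= 4 * (k ^ k) ^ 2 * K)%N.
Proof.
move=> mn hP; set B := [set _ | _].
have kk0 : 0 < (k ^ k)%:R :> R by rewrite ltr0n expn_gt0 ltnW.
pose s : R := (2 * (k ^ k)%:R)^-1.
have s0 : 0 < s by rewrite invr_gt0 mulr_gt0.
have a_ge : 2 * s <= a m ^+ k.
  have -> : 2 * s = k%:R^-1 ^+ k.
    by rewrite /s natrX exprVn; field; rewrite expf_neq0 // gt_eqF.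
  have h := free_frac_ge mn.
  by rewrite lerXn2r ?nnegrE ?invr_ge0 ?ler0n // a_ge0.
have dev_ge x : x \in B -> (s * v%:R) ^+ 2 <= dev V U (ideal m) x ^+ 2.
  rewrite inE => /andP[xcol]; rewrite -(ltr_nat R) !natrM => xs.
  have sv0 : 0 <= s * v%:R by rewrite mulr_ge0 // ltW.
  rewrite -[leRHS]sqrrN /dev /ideal xcol opprB /ideal_col -/(a m).
  have h1 : v%:R * (2 * s) <= v%:R * a m ^+ k by rewrite ler_wpM2l ?ler0n.
  have h2 : #|star V U x|%:R <= s * v%:R.
    by rewrite ler_pdivlMl ?mulr_gt0 // ltW.
  rewrite ler_sqr ?nnegrE //; lra.
have : #|B|%:R * (s * v%:R) ^+ 2 <= K%:R * v%:R ^+ 2.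
  apply: le_trans hP; rewrite /potential (bigID (mem B)) /= -[leLHS]addr0.
  apply: lerD; last by apply: sumr_ge0 => x _; apply: sqr_ge0.
  by rewrite mulr_natl -sumr_const; apply: ler_sum.
rewrite exprMn mulrA ler_pM2r ?exprn_gt0 // => hB.
have -> : (4 * (k ^ k) ^ 2 * K = K * (4 * (k ^ k) ^ 2))%N by rewrite mulnC.
rewrite -(ler_nat R) [leRHS]natrM.
have -> : #|B|%:R = #|B|%:R * s ^+ 2 * (4 * (k ^ k) ^ 2)%:R :> R.
  by rewrite [(4 * _)%:R]natrM natrX /s; field; rewrite gt_eqF.
by rewrite ler_wpM2r ?ler0n.
Qed.

End Nibble.

(** * Matchings covering all colours *)

Lemma sum_deg (W E : finType) (V : E -> {set W}) (A : {set W}) :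
  (\sum_(x in A) #|[set e | x \in V e]| = \sum_e #|V e :&: A|)%N.
Proof.
under eq_bigr do rewrite -sum1_card.
under [RHS]eq_bigr do rewrite -sum1_card.
rewrite (exchange_big_dep predT) //=; apply: eq_bigr => e _.
by apply: eq_bigl => x; rewrite !inE andbC.
Qed.

Lemma sum_deg_const (W E : finType) (V : E -> {set W}) (A : {set W}) j :
  (forall e, #|V e :&: A| = j) ->
  (\sum_(x in A) #|[set e | x \in V e]| = j * #|E|)%N.
Proof.
move=> cA; rewrite sum_deg (eq_bigr (fun=> j)) // sum_nat_const mulnC //.
Qed.

(** Each squared defect is at most [D] times the defect, so a bound on the total defect suffices. *)
Lemma sum_sqr_defect (R : realFieldType) (T : finType) (A : {set T})
    (f : T -> nat) (D L : nat) :
  (forall x, x \in A -> f x <= D)%N -> (#|A| * D <= \sum_(x in A) f x + L)%N ->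
  \sum_(x in A) ((f x)%:R - D%:R) ^+ 2 <= (D * L)%:R :> R.
Proof.
move=> fD hL.
apply: le_trans (_ : \sum_(x in A) D%:R * (D - f x)%:R <= _).
  apply: ler_sum => x xA; have := fD x xA => fxD.
  rewrite -sqrrN opprB -natrB // expr2 ler_wpM2r ?ler0n // ler_nat leq_subr //.
rewrite -mulr_sumr natrM ler_wpM2l ?ler0n // -natr_sum ler_nat.
rewrite -(leq_add2l (\sum_(x in A) f x)) -big_split /=.
by rewrite (eq_bigr (fun=> D)) ?sum_nat_const // => x xA; rewrite subnKC ?fD.
Qed.

(* [R] is only the field in which the estimates are carried out: computing in a
   concrete field would be slow. *)
Theorem colour_perfect_matching (R : archiRealFieldType) (k c C0 : nat) :
  (1 < k)%N -> exists v0 : nat,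
  forall (W E : finType) (V : E -> {set W}) (col : {set W}) (n v : nat),
    (v0 < v)%N -> (n <= v)%N -> (v <= c * n)%N ->
    (2 * k * n * k <= k.-1 * v)%N ->
    (forall e, #|V e :&: col| = 1%N) ->
    (forall e, #|V e :\: col| = k) ->
    (forall x y, x != y -> codeg V x y <= c)%N ->
    #|col| = n -> (2 * #|~: col| <= v)%N ->
    (forall x, x \in col -> #|[set e | x \in V e]| <= v)%N ->
    (forall x, x \in col -> v <= #|[set e | x \in V e]| + C0)%N ->
    (forall x, x \notin col -> #|[set e | x \in V e]| <= 2 * k * n)%N ->
  exists2 N, matching V N & col \subset cov V N.
Proof.
move=> k1.
(* About [n / q] colours are left to the greedy phase. [P0] and [K] bound the initial and final
   potentials in units of [v ^ 2], and [beta] the number of deficient colours. The threshold adds up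
   what is needed for the nibble, for placing the deficient colours, and for the completion. *)
pose r := k.+1; pose q := (4 * k ^ k * (r * c.+1))%N.
pose b := Num.bound (nibble_growth R k c / live_frac R k c q).
pose P0 := (C0 + 2 * k ^ 2 * C0)%N.
pose K := (P0.+1 * 8 ^ b)%N.
pose beta := (4 * (k ^ k) ^ 2 * K)%N.
pose v1 := Num.bound (2 * K%:R / live_frac R k c q ^+ 2).
exists (v1 + (r * c * beta + C0) + 4 * k ^ k * (r * c * (beta + 1 + r * beta)))%N.
move=> W E V col n v v0_lt nv vcn room cVcol cVpt codegP ccol cpt degcol degcolge degpt.
have kk0 : (0 < k ^ k)%N by rewrite expn_gt0 ltnW.
have n0 : (0 < n)%N.
  by case: (n) vcn v0_lt => //; rewrite muln0 leqn0 => /eqP->; rewrite ltn0.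
have c0 : (0 < c)%N.
  by case: (c) vcn v0_lt => //; rewrite mul0n leqn0 => /eqP->; rewrite ltn0.
have q_gt1 : (1 < q)%N by rewrite /q /r; nia.
have q0 : (0 < q)%N := ltnW q_gt1.
have cE : (n * v <= #|E| + C0 * n)%N.
  rewrite -[#|E|]mul1n -(sum_deg_const cVcol).
  rewrite -ccol [(C0 * _)%N]mulnC -!sum_nat_const -big_split /=.
  exact: leq_sum.
have cE' : (#|E| <= v ^ 2)%N.
  rewrite -[#|E|]mul1n -(sum_deg_const cVcol).
  apply: leq_trans (_ : n * v <= _)%N; last by rewrite -mulnn leq_mul2r nv orbT.
  by rewrite -ccol -sum_nat_const; apply: leq_sum.
have cW : (#|W| <= 2 * v)%N.
  by rewrite -(cardsC col) ccol mul2n -addnn leq_add // (leq_trans _ cpt) // leq_pmull.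
have degP x : (#|[set e | x \in V e]| <= 2 * k * v)%N.
  case: (boolP (x \in col)) => xc.
    by apply: leq_trans (degcol x xc) _; rewrite leq_pmull // muln_gt0 /= ltnW.
  by apply: leq_trans (degpt x xc) _; rewrite leq_mul2l nv orbT.
have star0 x : star V set0 x = [set e | x \in V e].
  apply/setP => e; rewrite !inE; case: (x \in V e) => //=.
  by rewrite disjoint_sym disjoints_subset sub0set.
have pot0 : potential V set0 (ideal R col k n v 0) <= P0%:R * v%:R ^+ 2.
  have a0 : free_frac R k v 0 = 1 by rewrite /free_frac muln0 mul0r subr0.
  rewrite /potential (bigID (mem col)) /= /P0 natrD mulrDl; apply: lerD.
    have -> : \sum_(x in col) dev V set0 (ideal R col k n v 0) x ^+ 2 =
      \sum_(x in col) (#|[set e | x \in V e]|%:R - v%:R) ^+ 2.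
      apply: eq_bigr => x xc.
      by rewrite /dev star0 /ideal xc /ideal_col a0 expr1n mulr1.
    apply: le_trans (sum_sqr_defect _ (L := C0 * n) degcol _) _.
      by rewrite (sum_deg_const cVcol) mul1n ccol.
    rewrite -natrX -natrM ler_nat mulnCA leq_mul2l -mulnn leq_mul2l nv !orbT //.
  have -> : \sum_(x | x \notin col) dev V set0 (ideal R col k n v 0) x ^+ 2 =
    \sum_(x in ~: col) (#|[set e | x \in V e]|%:R - (2 * k * n)%:R) ^+ 2.
    apply: eq_big => [x|x xc]; first by rewrite inE.
    by rewrite /dev star0 /ideal (negPf xc) /ideal_pt a0 expr1n mulr1 subn0.
  (* At most [v / 2] points of full degree [2 * k * n] would total [k * n * v]; the actual total is
     [k * #|E|], and [#|E|] falls short of [n * v] by at most [C0 * n]. *)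
  apply: le_trans (sum_sqr_defect _ (L := k * (C0 * n)) _ _) _.
  - by move=> x; rewrite inE; apply: degpt.
  - have -> : (\sum_(x in ~: col) #|[set e | x \in V e]| = k * #|E|)%N.
      by apply: sum_deg_const => e; rewrite -setDE.
    rewrite -mulnDr; apply: leq_trans (_ : k * (n * v) <= _)%N; last first.
      by rewrite leq_mul2l cE orbT.
    have -> : (#|~: col| * (2 * k * n) = k * (n * (2 * #|~: col|)))%N by ring.
    by rewrite !leq_mul2l cpt !orbT.
  rewrite -natrX -natrM ler_nat.
  have -> : (2 * k * n * (k * (C0 * n)) = 2 * k ^ 2 * C0 * n ^ 2)%N by ring.
  by rewrite leq_mul2l leq_exp2r // nv orbT.
(* The nibble stops with [u] colours uncovered: the successor gives [n < u * q], which lets it run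
   that far, and [u] is still small enough for the greedy phase. *)
pose u := (n %/ q).+1; have un : (u <= n)%N by rewrite ltn_Pdiv.
have h0 : 0 < live_frac R k c q.
  by rewrite /live_frac invr_gt0 mulr_gt0 // ltr0n muln_gt0 (muln_gt0 c) c0 q0.
have hb : nibble_growth R k c / live_frac R k c q <= b%:R.
  by rewrite ltW // archi_boundP // divr_ge0 ?nibble_growth_ge0 // ltW.
have KE : (P0%:R + 1) * 8 ^+ b = K%:R :> R by rewrite natr1 /K natrM natrX.
have hv : 2 * ((P0%:R + 1) * 8 ^+ b) <= live_frac R k c q ^+ 2 * v%:R.
  rewrite KE -ler_pdivrMl ?exprn_gt0 // mulrC.
  apply: le_trans (_ : v1%:R <= _).
    by rewrite ltW // archi_boundP // divr_ge0 ?exprn_ge0 ?(ltW h0) // mulr_ge0 ?ler0n.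
  by rewrite ler_nat; apply: leq_trans (ltnW v0_lt); rewrite -addnA leq_addr.
have [|M [mM cM pM]] := nibble k1 nv vcn n0 room cVcol cVpt codegP ccol degP cW
  cE' q0 hb pot0 hv (leq_subr u n).
  apply: leq_trans (ltnW (ltn_ceil n q0)) _; rewrite mulnC leq_mul2l.
  apply/orP; right; rewrite -/u -[X in (X <= _)%N](subKn un) leq_sub2l //.
  exact: leq_pred.
rewrite KE in pM.
set B := [set x in col | 2 * k ^ k * #|star V (cov V M) x| < v]%N.
have cB : (#|B| <= beta)%N.
  exact: (card_deficient_le k1 nv n0 room (leq_subr u n) pM).
have cV e : (#|V e| <= r)%N by rewrite -(cardsID col) cVcol cVpt.
have rcB : (r * c * #|B| <= r * c * beta)%N by rewrite leq_mul2l cB orbT.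
apply: (complete_matching cV codegP cVcol mM (Bad := B)).
- by apply/subsetP => x; rewrite inE => /andP[].
- move=> x; rewrite inE => /andP[xc _].
  apply: leq_ltn_trans rcB _; rewrite -(ltn_add2r C0).
  apply: leq_trans (degcolge x xc); apply: leq_ltn_trans v0_lt.
  by rewrite -addnA addnCA leq_addr.
move=> x xc; rewrite inE xc /= -leqNgt => xs.
rewrite ccol cM subKn //.
apply: leq_ltn_trans (_ : r * c * (beta + (u + r * beta)) < _)%N.
  by rewrite leq_mul2l !leq_add ?leq_mul2l ?cB ?orbT.
rewrite -(ltn_pmul2l (m := 2 * k ^ k)) ?muln_gt0 //.
apply: leq_trans xs.
have qn : (q * (n %/ q) <= v)%N by rewrite mulnC; apply: leq_trans (leq_trunc_div _ _) nv.
have h1 : (4 * k ^ k * (r * c * (beta + 1 + r * beta)) < v)%N.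
  by apply: leq_ltn_trans v0_lt; rewrite leq_addl.
have h2 : (4 * k ^ k * (r * c) * (n %/ q) <= v)%N.
  apply: leq_trans qn; rewrite leq_mul2r /q leq_mul2l; apply/orP; right.
  by rewrite leq_mul2l leqnSn !orbT.
(* Doubling splits the requirement in two: [h2] handles the part proportional to [n %/ q], and [h1]
   the constant part. *)
rewrite -(ltn_pmul2l (m := 2)) //.
have -> : (2 * (2 * k ^ k * (r * c * (beta + (u + r * beta)))) =
  4 * k ^ k * (r * c) * (n %/ q) + 4 * k ^ k * (r * c * (beta + 1 + r * beta)))%N.
  by rewrite /u; ring.
by rewrite mul2n -addnn -addnS leq_add.
Qed.

(** * The hypergraph of placements *)

Section Differences.

Variable G : finZmodType.
Implicit Types (A : {set G}) (a b d g x y : G).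

Lemma count_differences A d : d != 0 ->
  count_mem d (differences A) = #|[set f in A | f + d \in A]|.
Proof.
move=> d0; rewrite /differences /image_mem count_map -size_filter.
rewrite -(card_in_imset (f := fun f => (f + d, f))
  (D := mem [set f in A | f + d \in A])); last first.
  by move=> f f' _ _ [].
rewrite cardE; apply/perm_size/uniq_perm; last 1 first.
- move=> [u w]; rewrite mem_filter !mem_enum !inE /=; apply/andP/idP.
    case=> /eqP udw /andP[/andP[uA wA] _].
    by apply/imsetP; exists w; rewrite ?inE -udw ?wA [w + _]addrC subrK.
  move=> /imsetP[f]; rewrite !inE => /andP[fA fdA] [-> ->].
  rewrite addrC addKr eqxx fA fdA /=; split=> //.
  by rewrite -subr_eq0 addrC addKr.
- by apply: filter_uniq; apply: enum_uniq.
- exact: enum_uniq.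
Qed.

Lemma card_translate A g : #|translate A g| = #|A|.
Proof. by apply: card_imset; apply: addIr. Qed.

Lemma mem_translate A g x : (x \in translate A g) = (x - g \in A).
Proof.
apply/imsetP/idP => [[f fA ->]|xA]; first by rewrite addrK.
by exists (x - g); rewrite ?subrK.
Qed.

Lemma count_differences_translate A g d : d != 0 ->
  count_mem d (differences (translate A g)) = count_mem d (differences A).
Proof.
move=> d0; rewrite !count_differences // -(card_translate [set f in A | f + d \in A] g).
by apply: eq_card => x; rewrite !(inE, mem_translate) addrAC.
Qed.

Lemma count_flatten_differences n (F : 'I_n -> {set G}) d :
  count_mem d (flatten [seq differences (F i) | i <- enum 'I_n]) =
  (\sum_i count_mem d (differences (F i)))%N.
Proof.
by rewrite count_flatten sumnE !big_map -enumT big_enum.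
Qed.

Lemma difference_family_translate k lambda n (F : 'I_n -> {set G}) (g : 'I_n -> G) :
  difference_family k lambda F ->
  difference_family k lambda (fun i => translate (F i) (g i)).
Proof.
case=> kG cF dF; split=> // [i|d d0]; first by rewrite card_translate.
rewrite -(dF d d0) !count_flatten_differences; apply: eq_bigr => i _.
exact: count_differences_translate.
Qed.

(** If nonempty, the solution set is a coset of the kernel of doubling, which consists of 0 and the
    involutions. *)
Lemma card_double_le (s : G) :
  (#|[set g : G | (g + g)%R == s]| <= #|involutions G|.+1)%N.
Proof.
have [->|[g0]] := set_0Vmem [set g : G | (g + g)%R == s]; first by rewrite cards0.
rewrite inE => /eqP g0s; rewrite -(card_translate _ (- g0)).
apply: leq_trans (_ : #|0%R |: involutions G| <= _)%N; last first.
  by rewrite cardsU1; case: (_ \in _).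
apply/subset_leq_card/subsetP => x; rewrite mem_translate !inE opprK => /eqP xs.
case: (eqVneq x 0) => //= x0; apply/eqP/nt_prime_order => //.
rewrite FinRing.zmodXgE mulr2n; move: xs; rewrite -g0s addrACA => /eqP.
by rewrite -subr_eq0 addrK => /eqP.
Qed.

(* A choice of representatives for the pairs {x, -x}. *)
Definition rep x := if (enum_rank x <= enum_rank (- x))%N then x else - x.

Lemma rep_pm x : rep x = x \/ rep x = - x.
Proof. by rewrite /rep; case: ifP; [left|right]. Qed.

Lemma repN x : rep (- x) = rep x.
Proof.
rewrite /rep opprK; case: (leqP (enum_rank (- x))) => h1; case: leqP => // h2.
  by apply/esym/enum_rank_inj/ord_inj/eqP; rewrite eqn_leq h1 h2.
by have := ltn_trans h1 h2; rewrite ltnn.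
Qed.

Lemma repK x : rep (rep x) = rep x.
Proof. by case: (rep_pm x) => h; rewrite [in LHS]h ?repN. Qed.

Lemma rep_eq x y : rep x = rep y -> x = y \/ x = - y.
Proof.
by case: (rep_pm x) => ->; case: (rep_pm y) => -> h;
  [left|right|right; rewrite -h opprK|left; apply: oppr_inj].
Qed.

End Differences.

Section BlockHypergraph.

Variables (G : finZmodType) (k lambda n : nat) (F : 'I_n -> {set G}).
Hypothesis dF : difference_family k lambda F.

Let cF i : #|F i| = k. Proof. by case: dF. Qed.

(** With [f = b - g], such a placement is a pair [f], [f + (a - b)] in one block, that is, a
    representation of [a - b] as a difference. *)
Lemma card_incident (a b : G) : a != b ->
  #|[set ig : 'I_n * G | (a - ig.2 \in F ig.1) && (b - ig.2 \in F ig.1)]|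
  = lambda.
Proof.
move=> ab; have d0 : a - b != 0 by rewrite subr_eq0.
case: dF => _ _ /(_ _ d0) <-; rewrite count_flatten_differences.
rewrite -sum1_card (eq_bigl (fun ig : 'I_n * G => predT ig.1 &&
  ((a - ig.2 \in F ig.1) && (b - ig.2 \in F ig.1)))); last by move=> ig; rewrite inE.
rewrite -(pair_big_dep predT (fun i g => (a - g \in F i) && (b - g \in F i))
  (fun _ _ => 1%N)) /=.
apply: eq_bigr => i _; rewrite count_differences // sum1_card.
rewrite -(card_imset (mem [set f in F i | _]) (f := fun f => b - f)); last first.
  by move=> f f' /addrI/oppr_inj.
apply: eq_card => g; rewrite -topredE /=; apply/andP/imsetP.
  move=> [ag bg]; exists (b - g); last by rewrite opprB addrC subrK.
  by rewrite inE bg /= addrC addrA subrK.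
move=> [f]; rewrite inE => /andP[fF fabF] ->.
by rewrite !opprB !addrA ![_ + f]addrC -!addrA subrr addr0 [f + _]addrC;
  split=> //; rewrite addrC.
Qed.

(** Both sides count the ordered pairs of distinct elements of a block, by block and by
    difference. *)
Lemma family_size : (n * (k * k.-1) = lambda * #|G|.-1)%N.
Proof.
have -> : (lambda * #|G|.-1 = \sum_(d | d != 0%R :> G)
    \sum_i count_mem d (differences (F i)))%N.
  rewrite (eq_bigr (fun=> lambda)); last first.
    by case: dF => _ _ h d /h; rewrite count_flatten_differences.
  by rewrite sum_nat_const mulnC; congr (_ * _)%N; rewrite cardC1.
rewrite exchange_big /= -[n in LHS]card_ord -sum_nat_const.
apply: eq_bigr => i _.
have -> : (\sum_(d | d != 0%R :> G) count_mem d (differences (F i)) =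
  \sum_(d | d != 0%R :> G) \sum_(f in F i) ((f + d)%R \in F i))%N.
  by apply: eq_bigr => d d0; rewrite count_differences // card_setInd.
rewrite exchange_big /= -(cF i) -sum_nat_const; apply: eq_bigr => f fF.
rewrite (cardsD1 f) fF /= -sum1_card.
rewrite [RHS](reindex_inj (addrI (- f))) /= [RHS]big_mkcond [LHS]big_mkcond /=.
apply: eq_bigr => x _; rewrite !inE addNKr addrC subr_eq0.
by case: (x == f) => //=; case: (x \in F i).
Qed.

(** Elements with [x + x = 0] are left out, since a block disjoint from its negative contains none
    of them. *)
Definition point := {x : G | (rep x == x) && (x + x != 0)}.

(** Disjointness of the translate from its own negative; the case [f = f'] excludes elements equal
    to their opposites. *)
Definition valid (ig : 'I_n * G) :=
  [forall f in F ig.1, forall f' in F ig.1, f + ig.2 + (f' + ig.2) != 0].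

Definition placement := {ig : 'I_n * G | valid ig}.

Lemma validP (ig : 'I_n * G) x y : valid ig ->
  x - ig.2 \in F ig.1 -> y - ig.2 \in F ig.1 -> x + y != 0.
Proof.
by move=> /forall_inP h xF yF; have /forall_inP/(_ _ yF) := h _ xF; rewrite !subrK.
Qed.

Definition covers (ig : 'I_n * G) (x : G) :=
  (x - ig.2 \in F ig.1) || (- x - ig.2 \in F ig.1).

Definition edge (e : placement) : {set ('I_n + point)%type} :=
  [set w | match w with
           | inl i => i == (val e).1
           | inr y => covers (val e) (val y)
           end].

Definition colours : {set ('I_n + point)%type} :=
  [set w | if w is inl _ then true else false].

Lemma edge_colour e : #|edge e :&: colours| = 1%N.
Proof.
apply/eqP/cards1P; exists (inl (val e).1); apply/setP => -[i|y]; rewrite !inE.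
  by rewrite andbT.
by rewrite andbF.
Qed.

Lemma coversN ig x : covers ig (- x) = covers ig x.
Proof. by rewrite /covers opprK orbC. Qed.

Lemma covers_rep ig x : covers ig (rep x) = covers ig x.
Proof. by case: (rep_pm x) => ->; rewrite ?coversN. Qed.

Lemma covers_double ig x : valid ig -> covers ig x -> x + x != 0.
Proof.
move=> v /orP[] h; first exact: (validP v h h).
by rewrite -oppr_eq0 opprD; apply: (validP v h h).
Qed.

Lemma card_points (P : pred G) : #|[set y : point | P (val y)]| =
  #|[set x | [&& rep x == x, x + x != 0 & P x]]|.
Proof.
rewrite -(card_imset _ val_inj); apply: eq_card => x; rewrite !inE.
apply/imsetP/idP => [[y]|/and3P[rx xx Px]].
  by rewrite inE => Py ->; rewrite Py andbT; apply: (valP y).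
have h : (rep x == x) && (x + x != 0) by rewrite rx.
by exists (Sub x h); rewrite ?inE !SubK.
Qed.

(** Validity rules out [x = - y] within the translated block, so passing to representatives is
    injective on it. *)
Lemma edge_points e : #|edge e :\: colours| = k.
Proof.
have -> : edge e :\: colours = inr @: [set y : point | covers (val e) (val y)].
  apply/setP => w; apply/idP/imsetP => [|[y]].
    by case: w => [i|y]; rewrite !inE //= => h; exists y; rewrite ?inE.
  by rewrite inE => h ->; rewrite !inE.
rewrite card_imset; last by move=> ? ? [].
rewrite (card_points (covers (val e))); case: e => -[i g] /= v.
rewrite -(cF i) -(card_translate (F i) g) -[RHS](card_in_imset (f := @rep G)).
  apply: eq_card => x; rewrite inE; apply/idP/imsetP.
    case/and3P => /eqP rx xx /orP[] /= h.
      by exists x; rewrite ?mem_translate ?rx.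
    by exists (- x); rewrite ?mem_translate ?repN ?rx.
  case=> y; rewrite mem_translate => yF ->; rewrite repK eqxx covers_rep /=.
  have cy : covers (i, g) (rep y) by rewrite covers_rep /covers yF.
  by rewrite (covers_double v cy) /covers yF.
move=> x y; rewrite !mem_translate => xF yF /rep_eq[] // xy.
by have := validP (ig := (i, g)) v xF yF; rewrite xy addNr eqxx.
Qed.

Lemma card_colours : #|colours| = n.
Proof.
have -> : colours = inl @: [set: 'I_n].
  apply/setP => -[i|y]; rewrite !inE; first by rewrite imset_f.
  by apply/esym/imsetP => -[].
by rewrite card_imset ?cardsT ?card_ord // => ? ? [].
Qed.

(** The representatives and their negatives are disjoint subsets of [G] of equal size. *)
Lemma card_noncolours : (2 * #|~: colours| <= #|G|)%N.
Proof.
have -> : ~: colours = inr @: [set y : point | predT (val y)].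
  apply/setP => -[i|y]; rewrite !inE; first by apply/esym/imsetP => -[].
  by rewrite imset_f // inE.
rewrite card_imset; last by move=> ? ? [].
rewrite card_points; set P := [set x | _].
have cN : #|negate P| = #|P| by apply: card_imset; apply: oppr_inj.
rewrite mul2n -addnn -{2}cN -cardsUI [X in (_ + X)%N](_ : _ = 0%N) ?addn0 ?max_card //.
apply/eqP; rewrite cards_eq0 setI_eq0; apply/pred0Pn => -[x /= /andP[]].
rewrite inE => /and3P[/eqP rx xx _] /imsetP[y]; rewrite inE => /and3P[/eqP ry yy _].
by move=> xy; move: rx xx; rewrite xy repN ry => /eqP; rewrite -addr_eq0 (negPf yy).
Qed.

Lemma card_sub_pairs (Q : pred ('I_n * G)) (P : pred placement) :
  (forall e, P e -> Q (val e)) -> (#|[set e | P e]| <= #|[set ig | Q ig]|)%N.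
Proof.
move=> PQ; rewrite -(card_imset _ val_inj); apply/subset_leq_card/subsetP => ig.
by case/imsetP => e; rewrite !inE => /PQ h ->.
Qed.

Lemma card_covers_at i x :
  (#|[set ig : 'I_n * G | (ig.1 == i) && covers ig x]| <= 2 * k)%N.
Proof.
have sub (y : G) :
    (#|[set ig : 'I_n * G | (ig.1 == i) && ((y - ig.2)%R \in F ig.1)]| <= k)%N.
  rewrite -(cF i) -(card_imset (mem (F i)) (f := fun f => (i, y - f))); last first.
    by move=> f f' [] /addrI/oppr_inj.
  apply/subset_leq_card/subsetP => -[j g]; rewrite inE /= => /andP[/eqP-> h].
  by apply/imsetP; exists (y - g); rewrite // opprB addrC subrK.
rewrite mul2n -addnn; apply: leq_trans (leq_add (sub x) (sub (- x))).
apply: leq_trans (leq_card_setU _ _); apply/subset_leq_card/subsetP => ig.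
by rewrite !inE -andb_orr.
Qed.

Lemma edge_codeg w z : (2 * lambda <= k)%N -> w != z ->
  (codeg edge w z <= 2 * k)%N.
Proof.
move=> lk; case: w z => [i|x] [j|y] wz; rewrite /codeg.
- apply: leq_trans (_ : 0 <= _)%N => //; rewrite leqn0 cards_eq0; apply/eqP/setP => e.
  by rewrite !inE; apply/negP => /andP[/eqP hi /eqP hj]; rewrite hi hj eqxx in wz.
- apply: leq_trans (card_covers_at i (val y)); apply: card_sub_pairs => e.
  by rewrite !inE eq_sym.
- apply: leq_trans (card_covers_at j (val x)); apply: card_sub_pairs => e.
  by rewrite !inE eq_sym andbC.
set a := val x; set b := val y.
have ab : a != b by apply: contraNneq wz => /val_inj->.
have aNb : a != - b.
  apply: contraNneq ab => h.
  have /andP[/eqP ra _] := valP x; have /andP[/eqP rb _] := valP y.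
  by rewrite -/a -/b in ra rb; rewrite -ra h repN rb.
pose inc a b := [set ig : 'I_n * G | (a - ig.2 \in F ig.1) && (b - ig.2 \in F ig.1)].
have inc_le a' b' : a' != b' -> (#|inc a' b'| <= lambda)%N by move=> /card_incident->.
apply: leq_trans (_ : #|inc a b :|: inc a (- b) :|: (inc (- a) b :|: inc (- a) (- b))|
  <= _)%N.
  rewrite -(card_imset _ val_inj); apply/subset_leq_card/subsetP => ig.
  case/imsetP => e; rewrite !inE /covers -/a -/b => h ->.
  by move: h; do 4! case: (_ \in _).
apply: leq_trans (leq_card_setU _ _) _.
apply: leq_trans (leq_add (leq_card_setU _ _) (leq_card_setU _ _)) _.
have := inc_le _ _ ab; have := inc_le _ _ aNb.
have := inc_le (- a) b; rewrite eqr_oppLR => /(_ aNb).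
have := inc_le (- a) (- b); rewrite (inj_eq oppr_inj) => /(_ ab).
lia.
Qed.

Lemma colour_deg_le i : (#|[set e | inl i \in edge e]| <= #|G|)%N.
Proof.
have -> : #|G| = #|[set ig : 'I_n * G | ig.1 == i]|.
  rewrite -cardsT -(card_imset (mem [set: G]) (f := pair i)); last by move=> ? ? [].
  apply: eq_card => -[j g]; rewrite inE /=; apply/imsetP/eqP => [[g' _ []]//|->].
  by exists g.
by apply: card_sub_pairs => e; rewrite inE eq_sym.
Qed.

Lemma colour_deg_ge i :
  (#|G| <= #|[set e | inl i \in edge e]| + k ^ 2 * #|involutions G|.+1)%N.
Proof.
have -> : #|[set e | inl i \in edge e]| = #|[set g | valid (i, g)]|.
  rewrite -[RHS](card_imset _ (f := pair i)); last by move=> ? ? [].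
  rewrite -[LHS](card_imset _ val_inj); apply: eq_card => -[j g].
  apply/imsetP/imsetP => [[e]|[g']]; rewrite !inE /= => h.
    move=> je; have E : (i, g) = val e by rewrite (eqP h) -je.
    by exists g; rewrite ?inE E ?(valP e).
  by move=> [-> ->]; exists (Sub (i, g') h); rewrite ?inE SubK.
rewrite -(cardsC [set g | valid (i, g)]) leq_add2l.
apply: leq_trans (_ : #|\bigcup_(p in setX (F i) (F i))
  [set g : G | ((g + g)%R == - (p.1 + p.2))%R]| <= _)%N.
  apply/subset_leq_card/subsetP => g; rewrite !inE => /forallPn[f].
  rewrite negb_imply => /andP[fF /forallPn[f']]; rewrite negb_imply => /andP[f'F].
  rewrite negbK /= => /eqP h; apply/bigcupP; exists (f, f'); rewrite !inE ?fF //=.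
  by rewrite -addr_eq0 addrC addrACA h.
apply: leq_trans (leq_card_bigcup _ _) _.
apply: leq_trans (_ : #|setX (F i) (F i)| * #|involutions G|.+1 <= _)%N.
  by rewrite -sum_nat_const; apply: leq_sum => p _; apply: card_double_le.
by rewrite cardsX cF mulnn.
Qed.

Lemma point_deg_le y : (#|[set e | inr y \in edge e]| <= 2 * k * n)%N.
Proof.
apply: leq_trans (_ : #|[set ig | covers ig (val y)]| <= _)%N.
  by apply: card_sub_pairs => e; rewrite inE.
have -> : [set ig | covers ig (val y)] = \bigcup_(i in [set: 'I_n])
    [set ig : 'I_n * G | (ig.1 == i) && covers ig (val y)].
  apply/setP => ig; rewrite inE; apply/idP/bigcupP => [h|[i _]].
    by exists ig.1; rewrite ?inE ?eqxx.
  by rewrite inE => /andP[].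
apply: leq_trans (leq_card_bigcup _ _) _.
apply: leq_trans (_ : \sum_(i in [set: 'I_n]) 2 * k <= _)%N.
  by apply: leq_sum => i _; apply: card_covers_at.
by rewrite sum_nat_const cardsT card_ord mulnC.
Qed.

Lemma banff_of_matching N : matching edge N -> colours \subset cov edge N ->
  exists g : 'I_n -> G,
    banff_difference_family k lambda (fun i => translate (F i) (g i)).
Proof.
move=> mN cN.
have ex i : exists e : placement, (e \in N) && ((val e).1 == i).
  have /bigcupP[e eN] : inl i \in cov edge N by rewrite (subsetP cN) ?inE.
  by rewrite inE => /eqP->; exists e; rewrite eN eqxx.
pose e i := xchoose (ex i); pose g i := (val (e i)).2.
have eN i : e i \in N by have /andP[] := xchooseP (ex i).
have eE i : val (e i) = (i, g i).
  by have /andP[_ /eqP h] := xchooseP (ex i); rewrite [LHS]surjective_pairing h.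
have sgn i s x : x \in signed_block (fun i => translate (F i) (g i)) (i, s) ->
    (if s then - x else x) - g i \in F i.
  rewrite /signed_block /=; case: s; last by rewrite mem_translate.
  by case/imsetP => y; rewrite mem_translate => yF ->; rewrite opprK.
exists g; split; first exact: difference_family_translate.
move=> [i s] [j t] ij; apply/pred0Pn => -[x /= /andP[/sgn xi /sgn xj]].
have [eij|nij] := eqVneq i j.
  subst j; have st : s != t by apply: contraNneq ij => ->.
  have vi : valid (i, g i) by rewrite -eE; apply: (valP (e i)).
  have := validP vi xi xj; move: st; case: s {ij xi}; case: t {xj} => // _.
    by rewrite addNr eqxx.
  by rewrite addrN eqxx.
have covi : covers (val (e i)) x.
  by rewrite eE /covers /=; case: (s) xi => ->; rewrite ?orbT.
have covj : covers (val (e j)) x.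
  by rewrite eE /covers /=; case: (t) xj => ->; rewrite ?orbT.
have px : (rep (rep x) == rep x) && (rep x + rep x != 0).
  by rewrite repK eqxx (covers_double (valP (e i))) // covers_rep.
have eij : e i != e j.
  by apply: contraNneq nij => /(congr1 val); rewrite !eE => -[->].
have := mN _ _ (eN i) (eN j) eij => /pred0P/(_ (inr (Sub (rep x) px))).
by rewrite /= !inE SubK !covers_rep covi covj.
Qed.

End BlockHypergraph.

Lemma family_size_bounds k lambda n v : (0 < lambda)%N ->
    (2 * lambda + 2 <= k)%N -> (1 < v)%N ->
    (n * (k * k.-1) = lambda * v.-1)%N ->
  [/\ n <= v, v <= k ^ 2 * n & 2 * k * n * k <= k.-1 * v]%N.
Proof.
case: k v => [|j] [|w] //=; rewrite ?ltnS => l0 lj w0 E; first by lia.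
have n0 : (0 < n)%N by nia.
have hl : (2 * (j.+1 * lambda) <= j * j)%N by nia.
split.
- have : (n * (lambda * 1) <= lambda * w)%N by rewrite -E leq_mul2l; nia.
  by rewrite muln1 mulnC leq_pmul2l //; lia.
- have : (1 * w <= n * (j.+1 * j))%N by rewrite E leq_mul2r l0 orbT.
  by rewrite -mulnn; nia.
- rewrite -(leq_pmul2r (m := j)); last by lia.
  have -> : (2 * j.+1 * n * j.+1 * j = 2 * j.+1 * (lambda * w))%N.
    by rewrite -E; ring.
  have -> : (2 * j.+1 * (lambda * w) = 2 * (j.+1 * lambda) * w)%N by ring.
  have -> : (j * w.+1 * j = j * j * w.+1)%N by ring.
  by rewrite leq_mul.
Qed.

Theorem theorem1p6 (C k lambda : nat) (hC : (0 < C)%N) (hk : (0 < k)%N)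
    (hlambda : (0 < lambda)%N) (hklambda : (2 * lambda + 2 <= k)%N) :
  exists v0 : nat,
    forall G : finZmodType,
      (v0 < #|G|)%N ->
      (#|involutions G| <= C)%N ->
      forall (n : nat) (F : 'I_n -> {set G}),
        difference_family k lambda F ->
        exists g : 'I_n -> G,
          banff_difference_family k lambda (fun i : 'I_n => translate (F i) (g i)).
Proof.
have k1 : (1 < k)%N by lia.
have lk : (2 * lambda <= k)%N by lia.
have [v0 main] := @colour_perfect_matching rat k (k ^ 2) (k ^ 2 * C.+1) k1.
exists v0.+1 => G v0G invC n F dF.
have [n_le v_le room] := family_size_bounds hlambda hklambda
  (leq_ltn_trans (ltn0Sn _) v0G) (family_size dF).
have codegP w z : w != z -> (codeg (edge (F := F)) w z <= k ^ 2)%N.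
  move=> wz; apply: leq_trans (edge_codeg dF lk wz) _.
  by rewrite -mulnn leq_mul2r k1 orbT.
have [|||N mN cN] := main _ _ (edge (F := F)) (colours G n) n #|G|
  (ltnW v0G) n_le v_le room (edge_colour (F := F)) (edge_points dF) codegP
  (card_colours G n) (card_noncolours G n).
- case=> [i|y]; rewrite inE // => _; exact: colour_deg_le.
- case=> [i|y]; rewrite inE // => _; apply: leq_trans (colour_deg_ge dF i) _.
  by rewrite leq_add2l leq_mul2l ltnS invC orbT.
- case=> [i|y]; rewrite inE // => _; exact: point_deg_le dF y.
exact: (banff_of_matching dF mN cN).
Qed.
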